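(* For every fixed parameter $t\in\mathbb N$ there exists a statistical zero-knowledge distributed interactive proof such that, for every Sumcheck-instance $(G,F,q,a)$, where $F$ is an $N$-variable polynomial of individual degree $d$ over the finite field $\mathbb F_q$, the following holds. (Completeness) If $\sum_{x\in\{0,1\}^N}F(x)=a$, then (with the honest prover) all nodes accept with probability $1$. (Soundness) If $\sum_{x\in\{0,1\}^N}F(x)\neq a$, then for every prover strategy all nodes accept with probability at most $\frac{Nd}{q}+\frac1t$. The protocol runs for $O(N)$ rounds, each round requiring messages of $O(\log q)$ bits between the prover and each node. Moreover, the verification algorithm and the simulator both belong to the class $\mathcal C[O(1),O(N\log q)]$, requiring a single oracle query to $F$.
   Context: Sumcheck-instance: a tuple $(G,F,q,a)$ where $G=(V,E)$ is a connected $n$-node communication graph with unique node identifiers $\{0,\dots,n-1\}$, $q$ is a prime, $F:\mathbb F_q^N\to\mathbb F_q$ is an $N$-variate polynomial of individual degree (degree in each single variable) at most $O(n)$, and $a\in\mathbb F_q$. Each node receives $q$, $a$, its own identifier and the identifier of its parent in an arbitrary spanning tree of $G$ rooted at the node with identifier $0$ as input, and the nodes have oracle access to $F$ (evaluation of $F$ at a queried point). Write $I(v)$ for the input of node $v$. The parameter $t$ is a constant (hidden in the $O(\cdot)$ for message size). Class $\mathcal C[a,b]$: (randomized) synchronous distributed algorithms on $G$ running in $a$ communication rounds in which neighbours exchange at most $b$ bits over each edge per round. Distributed interactive proof (dIP): the $n$ nodes (the distributed verifier, using randomness) interact with a single computationally unbounded untrusted prover in $r$ synchronous alternating rounds, the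 last one being the prover's; in a prover round the prover sends each node an $\ell$-bit message, in a verifier round each node sends the prover an $\ell$-bit message. Then, without the prover, the nodes run a distributed verification algorithm from a given class, after which each node accepts or rejects. Statistical zero-knowledge: the view of node $v$ in a dIP $\Pi$ on $(G,I)$ is the random variable consisting of all values given to $v$ by the prover or by its neighbours during $\Pi$ (with honest prover). $\Pi$ is statistical zero-knowledge with simulators from a class $\mathcal A_S$ of distributed algorithms if there is $S\in\mathcal A_S$ (run without the prover) such that for every yes-instance (here: $\sum_{x\in\{0,1\}^N}F(x)=a$) and every node $v$, the distribution of the output of $S$ at $v$ and the distribution of the view of $v$ in $\Pi$ are statistically indistinguishable, i.e. for every polynomial $p$ their total variation distance is at most $1/p(n)$ for all sufficiently large $n$. *)

(* Defs.v *)
From HB Require Import structures.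
From mathcomp Require Import all_boot all_order all_algebra.
From mathcomp Require Import mpoly.

Set Implicit Arguments.
Unset Strict Implicit.
Unset Printing Implicit Defensive.

Import Order.TTheory GRing.Theory Num.Theory.
Local Open Scope ring_scope.

(* All random coins are uniform over finite sets, so probabilities are
   rational; independent coins are modelled by product sample spaces. *)
Definition prob (T : finType) (A : pred T) : rat :=
  #|[set w | A w]|%:R / #|T|%:R.

(* Total variation distance between the laws of X and Y: half the l1-distance,
   summed over the finitely many values attained by X or Y. *)
Definition tvdist (S T : finType) (V : eqType) (X : S -> V) (Y : T -> V) : rat :=
  2^-1 * \sum_(y <- undup (codom X ++ codom Y))
    `|prob (fun w => X w == y) - prob (fun w => Y w == y)|.

(* Only the degree bound in each single variable is constrained. *)
Definition individual_degree_le (N : nat) (R : nzRingType) (d : nat)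
    (F : {mpoly R[N]}) : Prop :=
  forall m, m \in msupp F -> forall i : 'I_N, (m i <= d)%N.

(* Nodes are identified with their identifiers 0, ..., n-1. *)
Record instance (N d q n : nat) := Instance {
  adj : rel 'I_n;
  poly_F : {mpoly 'F_q[N]};
  target : 'F_q;
  parent : 'I_n -> option 'I_n;
  n_gt0 : (0 < n)%N;
  q_prime : prime q;
  adj_sym : ssrbool.symmetric adj;
  adj_irr : irreflexive adj;
  adj_connected : forall u v : 'I_n, connect adj u v;
  degree_F : individual_degree_le d poly_F;
  parent_root : forall v : 'I_n, parent v = None <-> v = 0%N :> nat;
  parent_adj : forall u v : 'I_n, parent v = Some u -> adj v u;
  parent_tree : forall v : 'I_n, exists2 r : 'I_n, r = 0%N :> nat &
    connect (fun x y => parent x == Some y) v r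
}.

Definition cube_sum (N q : nat) (F : {mpoly 'F_q[N]}) : 'F_q :=
  \sum_(x : {ffun 'I_N -> bool}) F.@[fun i => (x i)%:R].

Definition yes_instance (N d q n : nat) (I : instance N d q n) : Prop :=
  cube_sum (poly_F I) = target I.

(* What a node knows initially. It recognizes its incident edges by the
   identifiers of the other endpoints; it is not given n. *)
Record local_input (q : nat) := LocalInput {
  li_target : 'F_q;
  li_id : nat;
  li_parent : option nat;
  li_neighbours : seq nat
}.

Definition input (N d q n : nat) (I : instance N d q n) (v : 'I_n) :
    local_input q :=
  LocalInput (target I) (val v) (omap val (parent I v))
    [seq val u | u <- enum 'I_n & adj I v u].

Inductive oracle_comp (N q : nat) (A : Type) : Type :=
| Return of A
| Query of ('I_N -> 'F_q) & ('F_q -> oracle_comp N q A).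

(* Result of the computation, together with the number of queries made. *)
Fixpoint oracle_run (N q : nat) (A : Type) (F : {mpoly 'F_q[N]})
    (c : oracle_comp N q A) : A * nat :=
  match c with
  | Return y => (y, 0%N)
  | Query x k => let: (y, m) := oracle_run F (k F.@[x]) in (y, m.+1)
  end.

(* Messages received by a node in one round, tagged with the sender. *)
Definition inbox (b : nat) : Type := seq (nat * b.-bseq bool).

(* Randomized synchronous distributed algorithm with oracle access, giving each
   node an auxiliary input in X and an output in Y. The coin of a node is
   uniform in {0, ..., alg_coins li}, where li is its local input. *)
Record dist_alg (N q : nat) (X Y : Type) := DistAlg {
  alg_rounds : nat;
  alg_bits : nat;
  alg_coins : local_input q -> nat;
  alg_state : Type;
  alg_init : local_input q -> X -> nat -> oracle_comp N q alg_state;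
  alg_send : nat -> alg_state -> nat -> alg_bits.-bseq bool;
  alg_recv : nat -> alg_state -> inbox alg_bits -> oracle_comp N q alg_state;
  alg_out : alg_state -> Y
}.

(* The class C[a, b]. Both endpoints of an edge send a message in each round,
   hence the factor 2. *)
Definition in_class (N q : nat) (X Y : Type) (A : dist_alg N q X Y)
    (a b : nat) : Prop :=
  (alg_rounds A <= a)%N /\ ((alg_bits A).*2 <= b)%N.

Definition node_coins (N d q n : nat) (I : instance N d q n)
    (c : local_input q -> nat) : finType :=
  {dffun forall v : 'I_n, 'I_(c (input I v)).+1}.

Record node_run (S : Type) (b : nat) := NodeRun {
  nr_state : S;
  nr_inboxes : seq (inbox b);
  nr_queries : nat
}.

Section Execution.

Variables (N d q n : nat) (I : instance N d q n) (X Y : Type).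
Variables (A : dist_alg N q X Y) (x : 'I_n -> X).
Variable w : node_coins I (alg_coins A).

Fixpoint alg_run (k : nat) : 'I_n -> node_run (alg_state A) (alg_bits A) :=
  match k with
  | 0 => fun v =>
      let: (s, m) :=
        oracle_run (poly_F I) (alg_init A (input I v) (x v) (val (w v))) in
      NodeRun s [::] m
  | k'.+1 => fun v =>
      let prev := alg_run k' in
      let box := [seq (val u, alg_send k' (nr_state (prev u)) (val v))
                 | u <- enum 'I_n & adj I v u] in
      let: (s, m) :=
        oracle_run (poly_F I) (alg_recv k' (nr_state (prev v)) box) in
      NodeRun s (rcons (nr_inboxes (prev v)) box) (nr_queries (prev v) + m)
  end.

Definition alg_output (v : 'I_n) : Y :=
  alg_out (nr_state (alg_run (alg_rounds A) v)).

Definition alg_received (v : 'I_n) : seq (inbox (alg_bits A)) :=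
  nr_inboxes (alg_run (alg_rounds A) v).

(* Queries made by all the nodes together. *)
Definition alg_queries : nat :=
  (\sum_(v < n) nr_queries (alg_run (alg_rounds A) v))%N.

End Execution.

(* A (randomized) prover strategy. It may depend on the whole instance; in each
   of its rounds it sees its own coin and all messages exchanged so far, but not
   the private coins of the nodes. *)
Record prover (n l : nat) := Prover {
  pr_coins : nat;
  pr_msg : nat -> seq {ffun 'I_n -> l.-tuple bool} -> {ffun 'I_n -> l.-tuple bool}
}.

(* The message of a node in a verifier round depends on its local input, its
   private coin and the messages it has exchanged with the prover so far. The
   auxiliary input of the verification algorithm consists of that coin and of
   the list of all these messages. *)
Record dIP (N d q : nat) := DIP {
  ip_rounds : nat;
  ip_bits : nat;
  ip_coins : local_input q -> nat;
  ip_msg : local_input q -> nat -> seq (ip_bits.-tuple bool) ->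
    ip_bits.-tuple bool;
  ip_verif : dist_alg N q (nat * seq (ip_bits.-tuple bool)) bool;
  ip_honest : forall n : nat, instance N d q n -> prover n ip_bits
}.

(* Rounds 0, ..., r-1 alternate, and round r-1 is the prover's. *)
Definition prover_turn (r i : nat) : bool := odd (r - i).

Definition view_type (N d q : nat) (Pi : dIP N d q) : eqType :=
  (seq ((ip_bits Pi).-tuple bool) *
   seq (seq (nat * (alg_bits (ip_verif Pi)).-bseq bool)))%type.

Section Interaction.

Variables (N d q n : nat) (Pi : dIP N d q) (I : instance N d q n).
Variable P : prover n (ip_bits Pi).

(* Interaction coins of the nodes, their coins for the verification algorithm,
   and the coin of the prover. *)
Definition ip_sample : finType :=
  (node_coins I (ip_coins Pi) * node_coins I (alg_coins (ip_verif Pi))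
   * 'I_(pr_coins P).+1)%type.

Variable w : ip_sample.

Fixpoint ip_history (k : nat) : seq {ffun 'I_n -> (ip_bits Pi).-tuple bool} :=
  match k with
  | 0 => [::]
  | k'.+1 =>
      let h := ip_history k' in
      rcons h
        (if prover_turn (ip_rounds Pi) k' then pr_msg P (val w.2) h
         else [ffun v => ip_msg (input I v) (val (w.1.1 v))
                           [seq m v | m : {ffun _ -> _} <- h]])
  end.

Definition ip_transcript (v : 'I_n) : seq ((ip_bits Pi).-tuple bool) :=
  [seq m v | m : {ffun _ -> _} <- ip_history (ip_rounds Pi)].

Definition verif_input (v : 'I_n) : nat * seq ((ip_bits Pi).-tuple bool) :=
  (val (w.1.1 v), ip_transcript v).

Definition all_accept : bool :=
  [forall v : 'I_n, alg_output verif_input w.1.2 v].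

Definition view (v : 'I_n) : view_type Pi :=
  (mask (mkseq (prover_turn (ip_rounds Pi)) (ip_rounds Pi)) (ip_transcript v),
   alg_received verif_input w.1.2 v).

End Interaction.

Definition accept_prob (N d q n : nat) (Pi : dIP N d q) (I : instance N d q n)
    (P : prover n (ip_bits Pi)) : rat :=
  prob (fun w : ip_sample I P => all_accept w).

Definition simulator (N d q : nat) (Pi : dIP N d q) : Type :=
  dist_alg N q unit (view_type Pi).

Definition sim_output (N d q n : nat) (Pi : dIP N d q) (S : simulator Pi)
    (I : instance N d q n) (v : 'I_n) (w : node_coins I (alg_coins S)) :
    view_type Pi :=
  alg_output (fun=> tt) w v.

Definition single_query (N d q n : nat) (X Y : Type) (A : dist_alg N q X Y)
    (I : instance N d q n) : Prop :=
  forall (x : 'I_n -> X) (w : node_coins I (alg_coins A)),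
    (alg_queries x w <= 1)%N.

(* The constant c is the one hidden in "individual degree at most O(n)"; the
   threshold n0 does not depend on the instance. *)
Definition simulates (c : nat) (Pi : forall N d q : nat, dIP N d q)
    (S : forall N d q : nat, simulator (Pi N d q)) : Prop :=
  forall p : {poly rat}, exists n0 : nat, forall n : nat, (n0 <= n)%N ->
  0 < p.[n%:R] ->
  forall (N d q : nat) (I : instance N d q n), (d <= c * n)%N ->
  yes_instance I -> forall v : 'I_n,
  tvdist (@sim_output N d q n (Pi N d q) (S N d q) I v)
         (fun w : ip_sample I (ip_honest (Pi N d q) I) => view w v)
    <= (p.[n%:R])^-1.

(* Main.v *)
(* A distributed sumcheck. In round i the prover holds a univariate polynomial of
   degree d <= c n, which is too long for one node; its coefficients are cut
   into blocks of length 2c+1, block v being additively shared between the nodes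
   v and v+1, so that each node sees uniform values only. Correcting the i-th
   polynomial by a multiple of 'X (see [corrected]) makes all intermediate
   sumcheck tests hold automatically, and what remains is one linear test: the
   sum over the nodes of scalars b_v, computed by v from its shares and the
   sumcheck points r, has to be F(r).

   The b_v must not be revealed. In the first round the prover gives to each
   node a mask K_v in F_q^t, the K_v adding up to 0; after the root has chosen a
   uniform sigma in F_q^t, the test becomes sum_v (b_v sigma + K_v) = F(r) sigma,
   and the prover helps to sum up along the tree. If sum_v b_v <> F(r), then a
   single sigma passes whatever the masks are, which costs q^-t <= 1/t. For
   n >= 2 the view of a node consists of uniform values, except that the root
   also sees F(r) sigma; it is simulated perfectly, with one query by the root.

   If N d = 0, then F is constant on the relevant points and the root needs no
   help. *)
Require Import Defs.
From HB Require Import structures.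
From mathcomp Require Import all_boot all_order all_algebra.
From mathcomp Require Import mpoly zify ring.

Set Implicit Arguments.
Unset Strict Implicit.
Unset Printing Implicit Defensive.

Import Order.TTheory GRing.Theory Num.Theory.
Local Open Scope ring_scope.

(** * Uniform maps between finite sample spaces *)

Definition uniform_map (S T : finType) (g : S -> T) : Prop :=
  forall A : pred T, prob (fun s => A (g s)) = prob A.

Lemma uniform_comp (S T U : finType) (g : S -> T) (h : T -> U) :
  uniform_map g -> uniform_map h -> uniform_map (h \o g).
Proof. by move=> ug uh A; rewrite -(uh A) -(ug (fun y => A (h y))). Qed.

(* [(s, z) |-> (put s z, g s)] is an involution of [S * T]. *)
Lemma uniform_lens (S T : finType) (g : S -> T) (put : S -> T -> S) (s0 : S) :
    (forall s z, g (put s z) = z) -> (forall s z, put (put s z) (g s) = s) ->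
  uniform_map g.
Proof.
move=> gK putK A; pose tau (x : S * T) := (put x.1 x.2, g x.1).
have tauK : involutive tau by case=> s z; rewrite /tau /= putK gK.
have cardE : (#|[set s | A (g s)]| * #|T| = #|S| * #|[set z | A z]|)%N.
  rewrite -(cardsT T) -(cardsT S) -!cardsX -(card_imset _ (inv_inj tauK)).
  apply: eq_card => x; apply/imsetP/idP => [[y yA ->]|xA].
    by move: yA; rewrite !inE /= andbT.
  exists (tau x); last by rewrite tauK.
  by move: xA; rewrite !inE /= gK andbT.
have cS : (#|S|%:R : rat) != 0 by rewrite pnatr_eq0 -lt0n; apply/card_gt0P; exists s0.
have cT : (#|T|%:R : rat) != 0.
  by rewrite pnatr_eq0 -lt0n; apply/card_gt0P; exists (g s0).
apply/eqP; rewrite /prob eqr_div // -!natrM cardE mulnC; apply/eqP.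
by congr (_ * _)%:R.
Qed.

Lemma prob_le (T : finType) (A A' : pred T) :
  (forall w, A w -> A' w) -> prob A <= prob A'.
Proof.
move=> sAA'; rewrite /prob ler_wpM2r ?invr_ge0 ?ler0n // ler_nat subset_leq_card //.
by apply/subsetP => w; rewrite !inE; apply: sAA'.
Qed.

Lemma prob1 (T : finType) (A : pred T) (w0 : T) : (forall w, A w) -> prob A = 1.
Proof.
move=> allA; rewrite /prob (_ : [set w | A w] = setT) ?cardsT.
  by rewrite divff // pnatr_eq0 -lt0n; apply/card_gt0P; exists w0.
by apply/setP => w; rewrite !inE allA.
Qed.

(** Averaging over the second coordinate. It serves to fix the prover's coin, so that soundness need
    only be shown for a deterministic prover. *)
Lemma prob_pair_le (S T : finType) (A : pred (S * T)) (b : rat) :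
  0 <= b -> (forall z, prob (fun s => A (s, z)) <= b) -> prob A <= b.
Proof.
move=> b0 Ab; rewrite /prob card_prod natrM.
have [S0|S0] := posnP #|S|; first by rewrite S0 mul0r invr0 mulr0.
have [T0|T0] := posnP #|T|; first by rewrite T0 mulr0 invr0 mulr0.
have -> : #|[set w | A w]| = (\sum_(z : T) #|[set s | A (s, z)]|)%N.
  rewrite -sum1dep_card (eq_bigr (fun x : S * T => 1%N)) //.
  rewrite (eq_bigl (fun x : S * T => A (x.1, x.2))); last by case.
  rewrite -(pair_big_dep xpredT (fun s z => A (s, z)) (fun _ _ => 1%N)) /=.
  rewrite (exchange_big_dep xpredT) //=; apply: eq_bigr => z _.
  by rewrite sum1dep_card.
rewrite natr_sum ler_pdivrMr ?mulr_gt0 ?ltr0n //.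
apply: le_trans (_ : \sum_(z : T) (b * #|S|%:R) <= _).
  apply: ler_sum => z _; have := Ab z.
  by rewrite /prob ler_pdivrMr ?ltr0n.
by rewrite sumr_const -[_ *+ _]mulr_natr mulrA.
Qed.

Lemma tvdist_eq0 (S T : finType) (V : eqType) (X : S -> V) (Y : T -> V) :
  (forall y, prob (fun w => X w == y) = prob (fun w => Y w == y)) ->
  tvdist X Y = 0.
Proof.
move=> XY; rewrite /tvdist big1 ?mulr0 // => y _.
by rewrite XY subrr normr0.
Qed.

(** * Encoding finite types by bits and by coins *)

Definition bits_of (T : finType) (k : nat) (x : T) : k.-tuple bool :=
  nth [tuple of nseq k false] (enum {: k.-tuple bool}) (enum_rank x).

(** Decoding is total: a string that encodes nothing, which a cheating prover may send, is read as
    [x0]. *)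
Definition of_bits (T : finType) (x0 : T) (k : nat) (b : seq bool) : T :=
  odflt x0 [pick x | val (bits_of k x) == b].

Lemma bits_ofK (T : finType) (x0 : T) (k : nat) :
  (#|T| <= 2 ^ k)%N -> forall x : T, of_bits x0 k (bits_of k x) = x.
Proof.
move=> leTk x; rewrite /of_bits.
have szE : size (enum {: k.-tuple bool}) = (2 ^ k)%N by rewrite -cardE card_tuple card_bool.
case: pickP => [y|/(_ x)]; last by rewrite eqxx.
rewrite val_eqE /bits_of nth_uniq ?enum_uniq //; last 2 first.
- by rewrite szE (leq_trans (ltn_ord _)).
- by rewrite szE (leq_trans (ltn_ord _)).
by move/eqP/ord_inj/enum_rank_inj ->.
Qed.

(** The model only has coins uniform on an initial segment of the naturals; a uniform element of [T]
    is drawn by its rank. *)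
Definition of_coin (T : finType) (x0 : T) (k : nat) : T := nth x0 (enum T) k.

Lemma coin_ltn (T : finType) (x0 x : T) (m : nat) :
  m = #|T|.-1 -> (enum_rank x < m.+1)%N.
Proof. by move=> ->; rewrite prednK ?ltn_ord //; apply/card_gt0P; exists x0. Qed.

Lemma enum_rankK_coin (T : finType) (x0 x : T) : of_coin x0 (enum_rank x) = x.
Proof. by rewrite /of_coin nth_enum_rank. Qed.

Lemma of_coinK (T : finType) (x0 : T) (k : nat) :
  (k < #|T|.-1.+1)%N -> enum_rank (of_coin x0 k) = k :> nat.
Proof.
rewrite prednK; last by apply/card_gt0P; exists x0.
move=> ltk; rewrite /of_coin -[k]/(nat_of_ord (Ordinal ltk)).
by rewrite -enum_val_nth enum_valK.
Qed.

(** * The sumcheck protocol over a field *)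

Section Chain.

Variable F : fieldType.

(* The prover's polynomial [p] is corrected by a multiple of ['X] so that its
   values at 0 and 1 add up to the current claim [a]. No consistency check is
   left for the intermediate rounds, and the final claim is a linear function
   of the initial one and of the coefficients. *)
Definition corrected (p : {poly F}) (a : F) : {poly F} :=
  p + (a - p.[0] - p.[1]) *: 'X.

Fixpoint chain (p : nat -> {poly F}) (a : F) (r : seq F) : F :=
  if r is z :: r' then chain (fun i => p i.+1) (corrected (p 0%N) a).[z] r' else a.

Lemma corrected_sum (p : {poly F}) (a : F) :
  (corrected p a).[0] + (corrected p a).[1] = a.
Proof. by rewrite /corrected !hornerD !hornerZ !hornerX; ring. Qed.

Lemma corrected_id (p : {poly F}) (a : F) : p.[0] + p.[1] = a -> corrected p a = p.
Proof. by move=> <-; rewrite /corrected -addrA -opprD subrr scale0r addr0. Qed.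

(** The correction has degree 1, hence [0 < d]; for this reason the case $Nd = 0$ is treated
    apart. *)
Lemma size_corrected (d : nat) (p : {poly F}) (a : F) :
  (0 < d)%N -> (size p <= d.+1)%N -> (size (corrected p a) <= d.+1)%N.
Proof.
move=> d0 sp; rewrite (leq_trans (size_polyD _ _)) // geq_max sp.
by rewrite (leq_trans (size_scale_leq _ _)) // size_polyX ltnS.
Qed.

Lemma eq_chain (p p' : nat -> {poly F}) (a : F) (r : seq F) :
  (forall i, (i < size r)%N -> p i = p' i) -> chain p a r = chain p' a r.
Proof.
elim: r p p' a => //= z r IHr p p' a eqp.
by rewrite (eqp 0%N) //; apply: IHr => i ltir; apply: eqp.
Qed.

Lemma corrected_sum_poly (I : finType) (p : I -> {poly F}) (a : I -> F) :
  corrected (\sum_i p i) (\sum_i a i) = \sum_i corrected (p i) (a i).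
Proof.
by rewrite /corrected !horner_sum -!sumrB scaler_suml -big_split.
Qed.

(** The final claim is jointly linear in the polynomials and the initial claim. Thus each node can
    run the chain on its own shares, and the results add up. *)
Lemma chain_sum (I : finType) (p : I -> nat -> {poly F}) (a : I -> F) (r : seq F) :
  \sum_i chain (p i) (a i) r = chain (fun j => \sum_i p i j) (\sum_i a i) r.
Proof.
elim: r p a => //= z r IHr p a.
by rewrite corrected_sum_poly horner_sum (IHr (fun i j => p i j.+1)).
Qed.

End Chain.

(** * Sumcheck for abstract partial sums [H] and honest round polynomials [f] *)

Section Sumcheck.

Variables (F : finFieldType) (d m : nat).
Variables (H : seq F -> F) (f : seq F -> {poly F}).
Hypothesis d_gt0 : (0 < d)%N.
Hypothesis f_size : forall s, (size s < m)%N -> (size (f s) <= d.+1)%N.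
Hypothesis f_horner : forall s z, (size s < m)%N -> (f s).[z] = H (rcons s z).
Hypothesis f_sum : forall s, (size s < m)%N -> (f s).[0] + (f s).[1] = H s.

Lemma sumcheck_complete (s r : seq F) : (size s + size r = m)%N ->
  chain (fun i => f (s ++ take i r)) (H s) r = H (s ++ r).
Proof.
elim: r s => [|z r IHr] s /= szE; first by rewrite cats0.
have lts : (size s < m)%N by rewrite -szE -addSnnS leq_addr.
rewrite cats0 corrected_id ?f_sum // f_horner // -cat_rcons -IHr; last first.
  by rewrite size_rcons addSnnS.
by apply: eq_chain => i _; rewrite cat_rcons.
Qed.

Lemma card_horner_eq (p p' : {poly F}) : p != p' ->
  (size p <= d.+1)%N -> (size p' <= d.+1)%N -> (#|[set z | p.[z] == p'.[z]]| <= d)%N.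
Proof.
move=> neq sp sp'; rewrite cardE -ltnS.
apply: leq_trans (_ : size (p - p')%R <= _)%N; last first.
  by rewrite (leq_trans (size_polyD _ _)) // size_polyN geq_max sp.
apply: max_poly_roots; rewrite ?subr_eq0 ?enum_uniq //.
apply/allP => z; rewrite mem_enum inE => /eqP E.
by rewrite rootE hornerD hornerN E subrr.
Qed.

Lemma sum_tuple_cons (k : nat) (G : k.+1.-tuple F -> nat) :
  (\sum_r G r = \sum_z \sum_(r : k.-tuple F) G [tuple of z :: r])%N.
Proof.
rewrite pair_big /= (reindex (fun x : F * k.-tuple F => [tuple of x.1 :: x.2])) //=.
exists (fun r => (thead r, [tuple of behead r])) => [[z r] _|r _] /=.
  by congr (_, _); apply: val_inj.
by case/tupleP: r => z r; apply: val_inj.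
Qed.

(** A false claim makes the corrected polynomial differ from the honest one, so at most [d] values
    of the first point lead to a true claim. For the other values the claim stays false and
    induction applies. The strategy [p] may depend on the earlier points. *)
Lemma sumcheck_sound_card (p : seq F -> {poly F}) (k : nat) (s : seq F) (a : F) :
    (forall s', (size (p s') <= d.+1)%N) -> (size s + k = m)%N -> a != H s ->
  (\sum_(r : k.-tuple F) (chain (fun i => p (s ++ take i r)) a r == H (s ++ r))
     <= k * d * #|F| ^ k.-1)%N.
Proof.
move=> sp; elim: k s a => [|k IHk] s a szE neq.
  by rewrite big1 // => r _; rewrite tuple0 /= cats0 (negPf neq).
have lts : (size s < m)%N by rewrite -szE -addSnnS leq_addr.
rewrite sum_tuple_cons /= -addn1 mulnDl mul1n addnC mulnDl.
rewrite (bigID (fun z => (corrected (p s) a).[z] == (f s).[z])) /=.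
apply: leq_add.
  apply: leq_trans (_ : \sum_(z | (corrected (p s) a).[z] == (f s).[z]) #|F| ^ k <= _)%N.
    apply: leq_sum => z _; rewrite -[leqRHS]card_tuple -sum1_card.
    by apply: leq_sum => r _; case: (_ == _).
  rewrite sum_nat_const leq_mul2r -cardsE card_horner_eq ?orbT ?size_corrected ?f_size //.
  (* Equal polynomials would have the same sum of values at 0 and 1, which are [a] and [H s]. *)
  apply: contra neq => /eqP E.
  by rewrite -(corrected_sum (p s) a) E f_sum.
apply: leq_trans (_ : \sum_(z : F) k * d * #|F| ^ k.-1 <= _)%N; last first.
  (* For [k = 0] the exponent [k.-1] is truncated, but then both sides vanish. *)
  rewrite sum_nat_const; case: k {IHk szE} => [|k] /=; first by rewrite !muln0.
  by rewrite mulnCA -expnS.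
rewrite [leqRHS](bigID (fun z => (corrected (p s) a).[z] == (f s).[z])) /=.
apply: leq_trans (leq_addl _ _); apply: leq_sum => z neqz.
rewrite (leq_trans _ (IHk (rcons s z) (corrected (p s) a).[z] _ _)) //.
- apply: leq_sum => r _; rewrite cats0 cat_rcons.
  by rewrite (@eq_chain _ _ (fun i => p (rcons s z ++ take i r))) // => i _; rewrite cat_rcons.
- by rewrite size_rcons addSnnS.
- by rewrite -f_horner.
Qed.

End Sumcheck.

(** * Sums over the Boolean cube and the partial sums of a polynomial *)

Section CubeSum.

Variable R : nzRingType.

(** Recursive, so that the relation between consecutive partial sums holds by computation; values in
    any [V] allow for sums of polynomials. *)
Fixpoint bsum (V : zmodType) (k : nat) (G : seq R -> V) : V :=
  if k is k'.+1 then bsum k' (fun s => G (0 :: s)) + bsum k' (fun s => G (1 :: s))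
  else G [::].

Lemma eq_bsum (V : zmodType) (k : nat) (G G' : seq R -> V) :
  (forall s, size s = k -> G s = G' s) -> bsum k G = bsum k G'.
Proof.
elim: k G G' => [|k IHk] G G' E /=; first exact: E.
by congr (_ + _); apply: IHk => s sk; apply: E; rewrite /= sk.
Qed.

Lemma bsum_const (V : zmodType) (k : nat) (x : V) : bsum k (fun=> x) = x *+ 2 ^ k.
Proof. by elim: k => //= k ->; rewrite -mulrnDr addnn -mul2n expnS. Qed.

Lemma bsum_tuple (V : zmodType) (k : nat) (G : seq R -> V) :
  bsum k G = \sum_(x : k.-tuple bool) G [seq b%:R | b : bool <- x].
Proof.
elim: k G => [|k IHk] G /=.
  by rewrite (big_pred1 [tuple]) // => x; apply/esym/eqP; exact: tuple0.
rewrite !IHk (reindex (fun x : bool * k.-tuple bool => [tuple of x.1 :: x.2])) /=; last first.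
  exists (fun r => (thead r, [tuple of behead r])) => [[z r] _|r _] /=.
    by congr (_, _); apply: val_inj.
  by case/tupleP: r => z r; apply: val_inj.
rewrite -(pair_big xpredT xpredT (fun b (x : k.-tuple bool) =>
  G [seq (b : bool)%:R | b <- b :: x])) /=.
by rewrite big_bool /= addrC.
Qed.

End CubeSum.

Section PartialSums.

Variables (N d q : nat) (G : {mpoly 'F_q[N]}).
Hypothesis G_degree : individual_degree_le d G.
Local Notation F := 'F_q.

Definition eval_seq (s : seq F) : F := G.@[fun i => s`_i].

Definition partial_sum (s : seq F) : F :=
  bsum (N - size s) (fun x => eval_seq (s ++ x)).

(** The honest polynomial of the round that follows the points [s]. *)
Definition partial_poly (s : seq F) : {poly F} :=
  bsum (N - (size s).+1) (fun x =>
    mmap (@polyC F) (fun i : 'I_N => ([seq c%:P | c <- s] ++ 'X :: [seq c%:P | c <- x])`_i) G).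

Lemma cube_sumE : cube_sum G = partial_sum [::].
Proof.
rewrite /partial_sum /= subn0 bsum_tuple /cube_sum /eval_seq.
rewrite (reindex (fun t : N.-tuple bool => [ffun i => tnth t i])) /=; last first.
  exists (fun x : {ffun 'I_N -> bool} => [tuple x i | i < N]) => [t|x] _.
    by apply: eq_from_tnth => i; rewrite tnth_mktuple ffunE.
  by apply/ffunP => i; rewrite ffunE tnth_mktuple.
apply: eq_bigr => t _; apply: meval_eq => i.
by rewrite ffunE (nth_map false) ?size_tuple // -tnth_nth.
Qed.

Lemma horner_mmap (h : 'I_N -> {poly F}) (z : F) :
  (mmap (@polyC F) h G).[z] = G.@[fun i => (h i).[z]].
Proof.
rewrite mevalE /mmap horner_sum; apply: eq_bigr => m _.
by rewrite hornerM hornerC /mmap1 horner_prod; under eq_bigr do rewrite horner_exp.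
Qed.

Lemma bsum_horner (k : nat) (g : seq F -> {poly F}) (z : F) :
  (bsum k g).[z] = bsum k (fun x => (g x).[z]).
Proof. by elim: k g => //= k IHk g; rewrite hornerD !IHk. Qed.

Lemma partial_poly_horner (s : seq F) (z : F) :
  (partial_poly s).[z] = partial_sum (rcons s z).
Proof.
rewrite /partial_poly /partial_sum size_rcons bsum_horner; apply: eq_bsum => x sx.
rewrite horner_mmap /eval_seq; apply: meval_eq => i.
rewrite cat_rcons !nth_cat size_map; case: ltnP => [lti|lesi].
  by rewrite (nth_map 0) // hornerC.
have lti := ltn_ord i; case E: (i - size s)%N => [|j] /=; first by rewrite hornerX.
have ltj : (j < size x)%N by rewrite sx; lia.
by rewrite (nth_map 0) // hornerC.
Qed.

Lemma partial_poly_sum (s : seq F) : (size s < N)%N ->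
  (partial_poly s).[0] + (partial_poly s).[1] = partial_sum s.
Proof.
move=> lts; rewrite !partial_poly_horner /partial_sum !size_rcons.
rewrite (_ : N - size s = (N - (size s).+1).+1)%N /=; last by rewrite -subSn ?subSS.
by congr (_ + _); apply: eq_bsum => x _; rewrite cat_rcons.
Qed.

Lemma size_bsum (k e : nat) (g : seq F -> {poly F}) :
  (forall x, (size (g x) <= e)%N) -> (size (bsum k g) <= e)%N.
Proof.
elim: k g => //= k IHk g sg.
by rewrite (leq_trans (size_polyD _ _)) // geq_max !IHk.
Qed.

Lemma size_partial_poly (s : seq F) : (size s < N)%N ->
  (size (partial_poly s) <= d.+1)%N.
Proof.
move=> lts; apply: size_bsum => x; rewrite /mmap.
apply: (leq_trans (size_sum _ _ _)); apply/bigmax_leqP_seq => m mG _.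
rewrite mul_polyC (leq_trans (size_scale_leq _ _)) // /mmap1.
rewrite (bigD1 (Ordinal lts)) //= nth_cat size_map ltnn subnn /=.
(* Every variable but the one of index [size s] is replaced by a constant, so each monomial becomes
   a constant times a power of ['X]. *)
have [C ->] : exists C : F, \prod_(i < N | i != Ordinal lts)
    ([seq c%:P | c <- s] ++ 'X :: [seq c%:P | c <- x])`_i ^+ m i = C%:P.
  apply: (big_ind (fun p => exists C : F, p = C%:P)) => [|p p' [C ->] [C' ->]|i neqi].
  - by exists 1.
  - by exists (C * C'); rewrite polyCM.
  set y := nth _ _ _; suff [c ->] : exists c : F, y = c%:P.
    by exists (c ^+ m i); rewrite polyC_exp.
  rewrite /y nth_cat size_map; case: ltnP => [lti|lesi].
    by exists s`_i; rewrite (nth_map 0).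
  case E: (i - size s)%N => [|j] /=.
    by case/eqP: neqi; apply: val_inj; apply/eqP; rewrite /= eqn_leq lesi -subn_eq0 E.
  (* [size_bsum] asks for all [x], of any length; past the end of [x] the substituted value is 0. *)
  case: (ltnP j (size x)) => ltj; first by exists x`_j; rewrite (nth_map 0).
  by exists 0; rewrite nth_default ?size_map.
rewrite mulrC mul_polyC (leq_trans (size_scale_leq _ _)) // size_polyXn ltnS.
exact: G_degree.
Qed.

Lemma partial_sum_full (s : seq F) : size s = N -> partial_sum s = eval_seq s.
Proof. by move=> sN; rewrite /partial_sum sN subnn /= cats0. Qed.

(** If $d = 0$ all exponents vanish, and if $N = 0$ there are no variables; one query then
    determines the sum. *)
Lemma cube_sum_const : (N * d == 0)%N -> cube_sum G = G.@[fun=> 0] *+ 2 ^ N.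
Proof.
move=> Nd0; rewrite cube_sumE /partial_sum subn0 /= -(@bsum_const 'F_q).
apply: eq_bsum => x _; rewrite /eval_seq !mevalE; apply: eq_big_seq => m mG.
congr (_ * _); apply: eq_bigr => i _.
suff -> : m i = 0%N by rewrite !expr0.
apply/eqP; rewrite -leqn0 (leq_trans (G_degree mG i)) //.
by move: Nd0; rewrite muln_eq0 => /orP[/eqP N0|/eqP ->] //; case: i => i; rewrite {1}N0.
Qed.

End PartialSums.

(** * The protocol *)

Section Protocol.

Variables (N d q t c : nat).

Local Notation F := 'F_q.
Local Notation B := c.*2.+1.
Local Notation L := (up_log 2 q).

Definition block_pair : finType := ('rV[F]_B * 'rV[F]_B)%type.

(* The coefficients of a round polynomial are cut into blocks of length [B].
   Node [v] receives a share of block [v] (second component) and, if [v > 0],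
   one of block [v - 1] (first component). *)
Definition share_poly (v : nat) (y : block_pair) : {poly F} :=
  take_poly d.+1
    ((if v is v'.+1 then 'X^(B * v') * rVpoly y.1 else 0) + 'X^(B * v) * rVpoly y.2).

(** Node 0 alone starts from the claim [a], so that the initial claims of all nodes add up to
    [a]. *)
Definition contribution (v : nat) (a : F) (y : nat -> block_pair) (r : seq F) : F :=
  chain (fun i => share_poly v (y i)) (if v == 0%N then a else 0) r.

(* The points [r] of the sumcheck rounds, and the challenge [sigma] that
   separates the sum of the contributions from the masks. *)
Definition challenge : finType := (N.-tuple F * 'rV[F]_t)%type.

Definition challenge0 : challenge := ([tuple of nseq N 0], 0).

(* Components: the previous sumcheck point, the shares, the mask [K], and, in
   the last round, [sigma] and the masked sum [P] of the subtree. *)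
Definition msg : finType :=
  (F * block_pair * ('rV[F]_t * ('rV[F]_t * 'rV[F]_t)))%type.

Definition msg0 : msg := ((0, (0, 0)), (0, (0, 0))).
Definition msg_point (m : msg) : F := m.1.1.
Definition msg_blocks (m : msg) : block_pair := m.1.2.
Definition msg_K (m : msg) : 'rV[F]_t := m.2.1.
Definition msg_sigma (m : msg) : 'rV[F]_t := m.2.2.1.
Definition msg_P (m : msg) : 'rV[F]_t := m.2.2.2.

(** One point, two blocks of length $2c+1$ and three vectors of length $t$. *)
Definition msg_bits : nat := ((4 * c + 3 * t + 3) * L)%N.
Definition report_bits : nat := ((N + 2 * t) * L)%N.
Definition report : finType := (challenge * 'rV[F]_t)%type.
Definition report0 : report := (challenge0, 0).

Definition decode (b : seq bool) : msg := of_bits msg0 msg_bits b.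

(** [sigma] accompanies the last point, when the masks and all round polynomials are already
    fixed. *)
Definition verifier_msg (x : challenge) (j : nat) : msg :=
  ((x.1`_j, (0, 0)), (0, (if j == N.-1 then x.2 else 0, 0))).

(** The prover relays the root's last point to all nodes; message 0 precedes every point and carries
    0 instead. *)
Definition prover_msg (r : seq F) (sigma K P : 'rV[F]_t) (y : nat -> block_pair)
    (i : nat) : msg :=
  (((0 :: r)`_i, y i), (K, if i == N then (sigma, P) else (0, 0))).

Definition main_coins (li : local_input q) : nat :=
  if li_id li == 0%N then #|challenge|.-1 else 0%N.

Definition main_msg (li : local_input q) (k : nat) (h : seq (msg_bits.-tuple bool)) :
    msg_bits.-tuple bool :=
  bits_of msg_bits
    (if li_id li == 0%N then verifier_msg (of_coin challenge0 k) (size h)./2 else msg0).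

Section Transcript.

Variable tr : seq (msg_bits.-tuple bool).

(** With $2N+1$ rounds, the prover speaks in the rounds of even index. *)
Definition tr_msg (i : nat) : msg := decode (nth [tuple of nseq _ false] tr i.*2).

Definition tr_challenge : challenge :=
  ([tuple msg_point (tr_msg i.+1) | i < N], msg_sigma (tr_msg N)).

Definition tr_contribution (v : nat) (a : F) : F :=
  contribution v a (fun i => msg_blocks (tr_msg i)) tr_challenge.1.

Definition tr_report : report := (tr_challenge, msg_P (tr_msg N)).

Definition node_check (li : local_input q) (k : nat) (kids : seq report) (y : F) :
    bool :=
  [&& all (fun m : report => m.1 == tr_challenge) kids,
      msg_P (tr_msg N) ==
        tr_contribution (li_id li) (li_target li) *: tr_challenge.2
        + msg_K (tr_msg 0) + \sum_(m <- kids) m.2 &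
      (li_id li == 0%N) ==>
        (tr_challenge == of_coin challenge0 k) &&
        (msg_P (tr_msg N) == y *: tr_challenge.2)].

End Transcript.

Definition reports (box : seq (nat * report_bits.-bseq bool)) : seq report :=
  [seq of_bits report0 report_bits m.2
  | m : nat * report_bits.-bseq bool <- box & size m.2 != 0%N].

Definition aux_input : Type := (nat * seq (msg_bits.-tuple bool))%type.

Definition verif_state : Type :=
  (local_input q * aux_input * (inbox report_bits * F))%type.

(* A node recognizes its children by their messages being nonempty. *)
Definition main_verif : dist_alg N q aux_input bool :=
  @DistAlg N q aux_input bool 1 report_bits (fun=> 0%N) verif_state
    (fun li x _ => Return _ _ (li, x, ([::], 0)))
    (fun _ st u =>
       if li_parent st.1.1 == Some u then
         bseq_of_tuple (bits_of report_bits (tr_report st.1.2.2))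
       else [bseq])
    (fun _ st box =>
       if li_id st.1.1 == 0%N then
         Query (fun i => tnth (tr_challenge st.1.2.2).1 i)
           (fun y => Return _ _ (st.1, (box, y)))
       else Return _ _ (st.1, (box, 0)))
    (fun st => node_check st.1.2.2 st.1.1 st.1.2.1 (reports st.2.1) st.2.2).

Section HonestProver.

Variables (n : nat) (I : instance N d q n).

Definition tree_root : 'I_n := Ordinal (n_gt0 I).

Definition children_sum (V : zmodType) (f : 'I_n -> V) (v : 'I_n) : V :=
  \sum_(u | parent I u == Some v) f u.

(** Maps $f$ to $f$ minus its sum over the children; its inverse yields subtree sums without
    recursion on the tree. *)
Definition tree_mx : 'M[F]_n :=
  \matrix_(v, u) ((v == u)%:R - (parent I u == Some v)%:R).

Definition subtree_sum (b : 'I_n -> F) (v : 'I_n) : F :=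
  (invmx tree_mx *m \col_u b u) v 0.

(** The vector of index $v+1$ blinds block $v$ at node $v$ and is handed to node $v+1$. The indices
    0 and $n$ have a single holder and keep the messages of the first and the last node uniform. *)
Definition prover_coin : finType :=
  ({ffun 'I_N * 'I_n.+1 -> 'rV[F]_B} * {ffun 'I_n -> 'rV[F]_t})%type.

Definition prover_coin0 : prover_coin := ([ffun=> 0], [ffun=> 0]).

(* With a single node there is nobody to share the coefficients with. *)
Definition share (w : prover_coin) (v : 'I_n) (s : seq F) : block_pair :=
  if insub (size s) is Some i then
    (w.1 (i, widen_ord (leqnSn n) v),
     poly_rV (drop_poly (B * v) (partial_poly (poly_F I) s))
       - if n == 1%N then 0 else w.1 (i, lift ord0 v))
  else (0, 0).

(** The mask hides the subtree sum of a node. The root has mask 0, because its value is to be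
    compared with $F(r)\sigma$. *)
Definition mask_of (w : prover_coin) (v : 'I_n) : 'rV[F]_t :=
  if v == tree_root then 0 else w.2 v.

Definition honest_contribution (w : prover_coin) (r : seq F) (v : 'I_n) : F :=
  contribution v (target I) (fun i => share w v (take i r)) r.

Definition honest_K (w : prover_coin) (v : 'I_n) : 'rV[F]_t :=
  mask_of w v - children_sum (mask_of w) v.

Definition honest_P (w : prover_coin) (r : seq F) (sigma : 'rV[F]_t) (v : 'I_n) :
    'rV[F]_t :=
  mask_of w v + subtree_sum (honest_contribution w r) v *: sigma.

Definition honest_msg (w : prover_coin) (r : seq F) (sigma : 'rV[F]_t) (v : 'I_n)
    (i : nat) : msg :=
  prover_msg r sigma (honest_K w v) (honest_P w r sigma v)
    (fun j => share w v (take j r)) i.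

Definition main_prover : prover n msg_bits :=
  @Prover n msg_bits #|prover_coin|.-1
    (fun k h =>
       let i := (size h)./2 in
       let m j := decode (nth [ffun=> [tuple of nseq _ false]] h j.*2.+1 tree_root) in
       [ffun v => bits_of msg_bits
          (honest_msg (of_coin prover_coin0 k) (mkseq (fun j => msg_point (m j)) i)
             (msg_sigma (m i.-1)) v i)]).

End HonestProver.

Definition main_dIP : dIP N d q :=
  @DIP N d q N.*2.+1 msg_bits main_coins main_msg main_verif main_prover.

(** The local input does not tell which neighbours are children, so a value [P] is drawn for each
    neighbour. *)
Definition sim_coin (li : local_input q) : finType :=
  (challenge * {ffun 'I_N -> block_pair} *
   ('rV[F]_t * {ffun 'I_(size (li_neighbours li)) -> 'rV[F]_t}))%type.

Definition sim_coin0 (li : local_input q) : sim_coin li :=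
  (challenge0, [ffun=> (0, 0)], (0, [ffun=> 0])).

Definition extend (V : zmodType) (m : nat) (f : {ffun 'I_m -> V}) (i : nat) : V :=
  if insub i is Some j then f j else 0.

(* At the root [K] is determined by the value [y] of the polynomial. *)
Definition sim_view (li : local_input q) (z : sim_coin li) (box : seq (nat * bool))
    (y : F) : view_type main_dIP :=
  let: (x, ys, (K', f)) := z in
  let P u := extend f (index u (li_neighbours li)) in
  let b := contribution (li_id li) (li_target li) (extend ys) x.1 *: x.2
           + \sum_(m <- box | m.2) P m.1 in
  let K := if li_id li == 0%N then y *: x.2 - b else K' in
  (mkseq (fun i => bits_of msg_bits (prover_msg x.1 x.2 K (b + K) (extend ys) i)) N.+1,
   [:: [seq (m.1, if m.2 then bseq_of_tuple (bits_of report_bits ((x, P m.1) : report))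
                  else [bseq])
       | m <- box]]).

(** Only the law of each single view has to be right, so every node draws a challenge of its own.
    The one round of communication tells the nodes their children. *)
Definition main_sim : simulator main_dIP :=
  @DistAlg N q unit (view_type main_dIP) 1 1
    (fun li => #|sim_coin li|.-1)
    (local_input q * nat * (seq (nat * bool) * F))
    (fun li _ k => Return _ _ (li, k, ([::], 0)))
    (fun _ st u => if li_parent st.1.1 == Some u then [bseq true] else [bseq])
    (fun _ st box =>
       let box' := [seq (m.1, size m.2 != 0%N) | m : nat * 1.-bseq bool <- box] in
       if li_id st.1.1 == 0%N then
         Query (fun i => tnth (of_coin (sim_coin0 st.1.1) st.1.2).1.1.1 i)
           (fun y => Return _ _ (st.1, (box', y)))
       else Return _ _ (st.1, (box', 0)))
    (fun st => sim_view (of_coin (sim_coin0 st.1.1) st.1.2) st.2.1 st.2.2).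

End Protocol.

(** * Execution of the verification algorithm and of the simulator *)

Section Encoding.

Variables (N d q t c : nat).
Hypothesis q_pr : prime q.
Local Notation L := (up_log 2 q).

Lemma card_rV (m : nat) : #|{: 'rV['F_q]_m}| = (q ^ m)%N.
Proof. by rewrite card_mx mul1n card_Fp. Qed.

Lemma card_challenge : #|challenge N q t| = (q ^ (N + t))%N.
Proof. by rewrite card_prod card_tuple card_rV card_Fp // expnD. Qed.

Lemma leq_expn_bits (m : nat) : (q ^ m <= 2 ^ (m * L))%N.
Proof.
rewrite mulnC expnM; case: m => // m.
by rewrite leq_exp2r // up_logP.
Qed.

Lemma decodeK (m : msg q t c) : decode q t c (bits_of (msg_bits q t c) m) = m.
Proof.
apply: bits_ofK; apply: leq_trans (leq_expn_bits _).
rewrite /= !card_prod !card_rV card_Fp // -!expnD -!expnS -!expnD.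
by rewrite leq_exp2l ?prime_gt1 //; lia.
Qed.

Lemma report_bitsK (m : report N q t) :
  of_bits (report0 N q t) (report_bits N q t) (bits_of (report_bits N q t) m) = m.
Proof.
apply: bits_ofK; apply: leq_trans (leq_expn_bits _).
rewrite /report card_prod card_challenge card_rV -expnD.
by rewrite leq_exp2l ?prime_gt1 //; lia.
Qed.

End Encoding.

Lemma in_adj (N d q n : nat) (I : instance N d q n) (u v : 'I_n) :
  parent I u == Some v -> adj I v u.
Proof. by move=> /eqP/parent_adj; rewrite adj_sym. Qed.

Lemma is_root (N d q n : nat) (I : instance N d q n) (v : 'I_n) :
  (v == tree_root I) = (v == 0%N :> nat).
Proof. by []. Qed.

Lemma parent_input (N d q n : nat) (I : instance N d q n) (u v : 'I_n) :
  (li_parent (input I u) == Some (val v)) = (parent I u == Some v).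
Proof. by rewrite /=; case: (parent I u) => [x|] //=; rewrite !(inj_eq Some_inj) val_eqE. Qed.

(** * Sums along the spanning tree *)

Section Tree.

Variables (N d q n : nat) (I : instance N d q n).

Lemma tree_ind (Q : 'I_n -> Prop) :
  Q (tree_root I) -> (forall u v, parent I u = Some v -> Q v -> Q u) -> forall v, Q v.
Proof.
move=> Q0 QS v; have [r r0 /connectP[p pth E]] := parent_tree I v.
have {r0} r0 : r = tree_root I by exact: val_inj.
elim: p v pth E => [|u p IHp] v /= => [_ <-|/andP[/eqP vu pth] E]; first by rewrite r0.
by apply: (QS v u) => //; apply: IHp.
Qed.

Lemma parent_eq_none (v : 'I_n) : (parent I v == None) = (v == tree_root I).
Proof.
apply/eqP/eqP => [/parent_root v0|->]; first exact: val_inj.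
by apply/parent_root.
Qed.

Lemma sum_children_sum (V : zmodType) (f : 'I_n -> V) :
  \sum_v children_sum I f v = \sum_(u | u != tree_root I) f u.
Proof.
rewrite /children_sum (exchange_big_dep (fun u => u != tree_root I)) /=; last first.
  by move=> v u _ /eqP E; rewrite -parent_eq_none E.
apply: eq_bigr => u; rewrite -parent_eq_none; case E: (parent I u) => [v|] // _.
by rewrite (big_pred1 v) // => v'; rewrite /= (inj_eq Some_inj) eq_sym.
Qed.

(** When the equations are summed over all nodes, each node other than the root appears once as a
    child, and its value cancels. *)
Lemma sum_local (V : zmodType) (f b : 'I_n -> V) :
  (forall v, f v = b v + children_sum I f v) -> f (tree_root I) = \sum_v b v.
Proof.
move=> E; apply: (addIr (\sum_(v | v != tree_root I) f v)).
rewrite -{2}sum_children_sum -big_split /=.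
by transitivity (\sum_v f v); [rewrite [RHS](bigD1 (tree_root I)) | exact: eq_bigr].
Qed.

(** A row vector in the kernel is 0 at the root and takes the same value at each node as at its
    parent. *)
Lemma tree_mx_unit : tree_mx I \in unitmx.
Proof.
rewrite -row_free_unit -kermx_eq0; apply/rowV0P => g /sub_kermxP gE.
apply/rowP; apply: tree_ind => [|u v uv gv]; rewrite !mxE.
  have /rowP/(_ (tree_root I)) := gE; rewrite !mxE (bigD1 (tree_root I)) //= big1 => [|v].
    rewrite mxE eqxx; have /eqP -> : parent I (tree_root I) == None by rewrite parent_eq_none.
    by rewrite subr0 mulr1 addr0.
  rewrite mxE => /negPf ->; have /eqP -> : parent I (tree_root I) == None by rewrite parent_eq_none.
  by rewrite subr0 mulr0.
have /rowP/(_ u) := gE; rewrite !mxE.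
under eq_bigr do rewrite mxE mulrBr uv.
rewrite sumrB (bigD1 u) //= eqxx mulr1 big1 ?addr0; last first.
  by move=> w /negPf ->; rewrite mulr0.
rewrite (bigD1 v) //= eqxx mulr1 gv mxE big1 ?addr0 ?subr0 // => w neq.
by rewrite (inj_eq Some_inj) eq_sym (negPf neq) mulr0.
Qed.

Lemma subtree_sumE (b : 'I_n -> 'F_q) (v : 'I_n) :
  subtree_sum I b v = b v + children_sum I (subtree_sum I b) v.
Proof.
have /colP/(_ v) : tree_mx I *m (invmx (tree_mx I) *m \col_u b u) = \col_u b u.
  by rewrite mulKVmx // tree_mx_unit.
rewrite !mxE => <-; under eq_bigr do rewrite mxE mulrBl.
rewrite sumrB (bigD1 v) //= eqxx mul1r big1 ?addr0; last first.
  by move=> w; rewrite eq_sym => /negPf ->; rewrite mul0r.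
rewrite /children_sum [X in _ - X](bigID (fun u => parent I u == Some v)) /=.
rewrite [X in _ - (_ + X)]big1 => [|u /negPf ->]; last by rewrite mul0r.
rewrite addr0 /subtree_sum; under [X in _ - X + _]eq_bigr => u -> do rewrite mul1r.
by rewrite subrK.
Qed.

Lemma sum_children_nbrs (V : zmodType) (f : 'I_n -> V) (v : 'I_n) :
  \sum_(u <- [seq u <- enum 'I_n | adj I v u] | parent I u == Some v) f u
    = children_sum I f v.
Proof.
rewrite big_filter_cond big_enum_cond /=; apply: eq_bigl => u.
by apply: andb_idl; apply: in_adj.
Qed.

End Tree.

Section Execution.

Variables (N d q t c n : nat) (I : instance N d q n).

(** As $N > 0$ and $q > 1$, a report has positive length, so nonempty messages come exactly from the
    children. *)
Lemma reports_inbox (f : 'I_n -> report N q t) (v : 'I_n) : prime q -> (0 < N)%N ->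
  reports [seq (val u, if parent I u == Some v
       then bseq_of_tuple (bits_of (report_bits N q t) (f u)) else [bseq])
    | u <- enum 'I_n & adj I v u] = [seq f u | u <- enum 'I_n & parent I u == Some v].
Proof.
move=> q_pr N_gt0; rewrite /reports filter_map -map_comp -filter_predI.
have bits_gt0 : (0 < report_bits N q t)%N.
  by rewrite muln_gt0 addn_gt0 N_gt0 up_log_gt0 (prime_gt1 q_pr).
have sz u : (size (if parent I u == Some v
    then bseq_of_tuple (bits_of (report_bits N q t) (f u)) else [bseq]) != 0%N)
    = (parent I u == Some v).
  by case: ifP => _; rewrite ?size_tuple -?lt0n.
rewrite (@eq_filter _ _ (fun u => parent I u == Some v)) => [|u] /=; last first.
  by rewrite sz; apply/andb_idr/in_adj.
by apply/eq_in_map => u; rewrite mem_filter /= => /andP[-> _]; rewrite report_bitsK.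
Qed.

Section Verification.

Variable x : 'I_n -> aux_input q t c.
Variable w : node_coins I (alg_coins (main_verif N d q t c)).

Lemma main_verif_received (v : 'I_n) :
  alg_received x w v = [:: [seq (val u, if parent I u == Some v
       then bseq_of_tuple (bits_of (report_bits N q t) (tr_report N (x u).2)) else [bseq])
    | u <- enum 'I_n & adj I v u]].
Proof.
rewrite /alg_received /= fun_if /=; set box := [seq _ | u <- _].
transitivity [:: box]; first by case: ifP.
congr [:: _]; apply: eq_map => u; congr (_, _).
by rewrite parent_input.
Qed.

Lemma main_verif_queries : (alg_queries x w <= 1)%N.
Proof.
rewrite /alg_queries (bigD1 (tree_root I)) //= big1 ?addn0 => [|v] //.
by rewrite is_root => /negPf /=; case: ifP => /eqP // ->.
Qed.

Hypothesis q_pr : prime q.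
Hypothesis N_gt0 : (0 < N)%N.

Lemma main_verif_output (v : 'I_n) :
  alg_output x w v =
    node_check d (x v).2 (input I v) (x v).1
      [seq tr_report N (x u).2 | u <- enum 'I_n & parent I u == Some v]
      (if v == tree_root I then eval_seq (poly_F I) (tr_challenge N (x v).2).1 else 0).
Proof.
have := main_verif_received v; rewrite /alg_received /alg_output /= => rcv.
have evalE : eval_seq (poly_F I) (tr_challenge N (x v).2).1 =
    (poly_F I).@[fun i => tnth (tr_challenge N (x v).2).1 i].
  by apply: meval_eq => i; rewrite (tnth_nth 0).
rewrite is_root evalE; case: ifP rcv => v0 /= [->];
by congr node_check; apply: reports_inbox.
Qed.

End Verification.

Section Simulation.

Variable w : node_coins I (alg_coins (main_sim N d q t c)).

Lemma main_sim_queries (x : 'I_n -> unit) : (alg_queries x w <= 1)%N.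
Proof.
rewrite /alg_queries (bigD1 (tree_root I)) //= big1 ?addn0 => [|v] //.
by rewrite is_root => /negPf /=; case: ifP => /eqP // ->.
Qed.

Lemma main_sim_output (v : 'I_n) :
  let z := of_coin (sim_coin0 N t c (input I v)) (w v) in
  sim_output v w =
    sim_view d z [seq (val u, parent I u == Some v) | u <- enum 'I_n & adj I v u]
      (if v == tree_root I then eval_seq (poly_F I) z.1.1.1 else 0).
Proof.
move=> z; rewrite /sim_output /alg_output /=.
have evalE : eval_seq (poly_F I) z.1.1.1 = (poly_F I).@[fun i => tnth z.1.1.1 i].
  by apply: meval_eq => i; rewrite (tnth_nth 0).
have boxE : [seq (val u, parent I u == Some v) | u <- enum 'I_n & adj I v u] =
    [seq (m.1, size m.2 != 0%N) | m : nat * 1.-bseq bool <-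
      [seq (val u, if omap val (parent I u) == Some (val v) then [bseq true] else [bseq])
      | u <- enum 'I_n & adj I v u]].
  rewrite -map_comp; apply: eq_map => u /=; congr (_, _).
  by rewrite -(parent_input I u v) /=; case: ifP.
by rewrite is_root evalE boxE; case: ifP.
Qed.

End Simulation.
End Execution.

(** * Soundness *)

Section Coins.

Variables (N d q n : nat) (I : instance N d q n) (cf : local_input q -> nat).
Variables (v : 'I_n) (T : finType) (x0 : T).
Hypothesis cfE : cf (input I v) = #|T|.-1.

Definition set_coin (w : node_coins I cf) (z : T) : node_coins I cf :=
  [ffun u => dfwith w (Ordinal (coin_ltn x0 z cfE)) u].

Lemma set_coinK (w : node_coins I cf) (z : T) : of_coin x0 (set_coin w z v) = z.
Proof. by rewrite ffunE dfwith_in enum_rankK_coin. Qed.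

Lemma set_coin_id (w : node_coins I cf) (z : T) :
  set_coin (set_coin w z) (of_coin x0 (w v)) = w.
Proof.
apply/ffunP => u; rewrite ffunE; case: dfwithP => [|u' neq].
  by apply: val_inj; rewrite /= of_coinK -?cfE.
by rewrite ffunE dfwith_out.
Qed.

Lemma uniform_coin : uniform_map (fun w : node_coins I cf => of_coin x0 (w v)).
Proof.
have w0 : node_coins I cf := [ffun u => ord0].
exact: (@uniform_lens _ _ _ set_coin w0 set_coinK set_coin_id).
Qed.

End Coins.

Section Soundness.

Variables (N d q t c n : nat) (I : instance N d q n).
Variables (P : prover n (msg_bits q t c)) (k : nat).
Hypothesis N_gt0 : (0 < N)%N.
Hypothesis d_gt0 : (0 < d)%N.

Local Notation F := 'F_q.
Local Notation chal := (challenge N q t).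
Local Notation root := (tree_root I).

(** The history as a function of the root's challenge alone: the prover's coin is fixed to [k], and
    the other nodes send constant messages. *)
Fixpoint transcript (x : chal) (m : nat) : seq {ffun 'I_n -> (msg_bits q t c).-tuple bool} :=
  if m is m'.+1 then
    let h := transcript x m' in
    rcons h (if odd m' then
               [ffun v => bits_of _ (if v == root then verifier_msg c x m'./2 else msg0 q t c)]
             else pr_msg P k h)
  else [::].

Lemma size_transcript (x : chal) (m : nat) : size (transcript x m) = m.
Proof. by elim: m => //= m IHm; rewrite size_rcons IHm. Qed.

Lemma nth_transcript h0 (x : chal) (m j : nat) : (j < m)%N ->
  nth h0 (transcript x m) j = nth h0 (transcript x j.+1) j.
Proof.
elim: m => // m IHm; rewrite ltnS leq_eqVlt => /orP[/eqP -> //|ltjm].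
by rewrite [in LHS]/= nth_rcons size_transcript ltjm IHm.
Qed.

Lemma eq_transcript (x x' : chal) (m : nat) :
    (forall j, (j.*2.+1 < m)%N -> verifier_msg c x j = verifier_msg c x' j) ->
  transcript x m = transcript x' m.
Proof.
elim: m => //= m IHm E; rewrite (IHm (fun j lj => E j (ltnW lj))); congr rcons.
case: ifP => // om; apply/ffunP => v; rewrite !ffunE E //.
by rewrite ltnS -[X in (_ < X)%N](odd_double_half m) om.
Qed.

Definition prover_reply (x : chal) (v : 'I_n) (i : nat) : msg q t c :=
  decode q t c (pr_msg P k (transcript x i.*2) v).

(** Before message [i < N] the prover has seen the first [i] points and not [sigma]; hence
    polynomials and masks are committed to in time. *)
Lemma eq_prover_reply (x x' : chal) (v : 'I_n) (i : nat) : (i < N)%N ->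
  take i x.1 = take i x'.1 -> prover_reply x v i = prover_reply x' v i.
Proof.
move=> ltiN E; rewrite /prover_reply (@eq_transcript _ x') // => j ltj.
have ltji : (j < i)%N by lia.
rewrite /verifier_msg -(nth_take 0 ltji) E nth_take //.
by case: eqP => // jE; lia.
Qed.

Lemma tr_msg_transcript (x : chal) (v : 'I_n) (i : nat) : (i <= N)%N ->
  tr_msg [seq m v | m : {ffun _ -> _} <- transcript x N.*2.+1] i = prover_reply x v i.
Proof.
move=> leiN; have lti : (i.*2 < N.*2.+1)%N by rewrite ltnS leq_double.
rewrite /tr_msg (nth_map [ffun=> [tuple of nseq _ false]]) ?size_transcript //.
by rewrite nth_transcript //= nth_rcons size_transcript ltnn eqxx odd_double.
Qed.

(** Completes a prefix to a full challenge, so that a reply can be regarded as a function of the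
    points seen so far. *)
Definition pad (s : seq F) : chal := ([tuple s`_i | i < N], 0).

Lemma take_pad (s : seq F) (i : nat) : (i <= N)%N -> (i <= size s)%N ->
  take i (pad s).1 = take i s.
Proof.
move=> leiN leis; apply: (@eq_from_nth _ 0); first by rewrite !size_takel ?size_tuple.
move=> j; rewrite size_takel ?size_tuple // => ltji; rewrite !nth_take //.
have ltjN := leq_trans ltji leiN.
by rewrite -[j]/(nat_of_ord (Ordinal ltjN)) -tnth_nth tnth_mktuple.
Qed.

Definition committed_poly (s : seq F) : {poly F} :=
  \sum_(v < n) share_poly d v (msg_blocks (prover_reply (pad s) v (size s))).

(** The truncation in [share_poly] enforces the degree bound whatever the prover sends. *)
Lemma size_committed_poly (s : seq F) : (size (committed_poly s) <= d.+1)%N.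
Proof.
apply: (leq_trans (size_sum _ _ _)); apply/bigmax_leqP => v _.
exact: size_take_poly.
Qed.

Definition discrepancy (r : seq F) : F :=
  chain (fun i => committed_poly (take i r)) (target I) r - eval_seq (poly_F I) r.

Definition mask_sum : 'rV[F]_t := \sum_(v < n) msg_K (prover_reply (pad [::]) v 0).

Lemma sum_contribution (x : chal) :
  \sum_(v < n) contribution d v (target I) (fun i => msg_blocks (prover_reply x v i)) x.1
    = chain (fun i => committed_poly (take i x.1)) (target I) x.1.
Proof.
rewrite chain_sum -big_mkcond /= (big_pred1 root) //.
apply: eq_chain => i; rewrite size_tuple => ltiN; apply: eq_bigr => v _.
have szi : size (take i x.1) = i by rewrite size_takel // size_tuple ltnW.
rewrite szi (@eq_prover_reply _ (pad (take i x.1))) // take_pad ?szi // 1?ltnW //.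
by rewrite take_takel.
Qed.

Lemma accept_discrepancy (x : chal) :
    (forall v, node_check d [seq m v | m : {ffun _ -> _} <- transcript x N.*2.+1]
       (input I v) (if v == root then nat_of_ord (enum_rank x) else 0%N)
       [seq tr_report N [seq m u | m : {ffun _ -> _} <- transcript x N.*2.+1]
         | u <- enum 'I_n & parent I u == Some v]
       (if v == root then eval_seq (poly_F I) (tr_challenge N
          [seq m v | m : {ffun _ -> _} <- transcript x N.*2.+1]).1 else 0)) ->
  discrepancy x.1 *: x.2 = - mask_sum.
Proof.
set tr := fun v : 'I_n => [seq m v | m : {ffun _ -> _} <- transcript x N.*2.+1].
(* The root compares the announced challenge with its coins, and every other node is compared with
   its parent. *)
move=> acc; have chalE : forall v, tr_challenge N (tr v) = x.
  apply: (tree_ind (I := I)) => [|u v uv <-].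
    by have /and3P[_ _ /andP[/eqP -> _]] := acc root; rewrite eqxx enum_rankK_coin.
  have /and3P[/allP/(_ (tr_report N (tr u))) kids _ _] := acc v.
  by apply/eqP/kids/map_f; rewrite mem_filter uv eqxx mem_enum.
have local v : msg_P (prover_reply x v N) =
    (contribution d v (target I) (fun i => msg_blocks (prover_reply x v i)) x.1 *: x.2
     + msg_K (prover_reply x v 0)) + children_sum I (fun u => msg_P (prover_reply x u N)) v.
  have /and3P[_ /eqP] := acc v.
  rewrite -/(tr v) tr_msg_transcript // chalE => -> _.
  have -> : tr_contribution N d (tr v) (li_id (input I v)) (li_target (input I v)) =
      contribution d v (target I) (fun i => msg_blocks (prover_reply x v i)) x.1.
    rewrite /tr_contribution chalE; apply: eq_chain => i.
    by rewrite size_tuple => ltiN; rewrite tr_msg_transcript // ltnW.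
  rewrite tr_msg_transcript //; apply: (f_equal2 +%R) => //.
  rewrite big_map big_filter big_enum_cond; apply: eq_bigr => u _.
  by rewrite /= tr_msg_transcript.
(* Adding up the tree equations expresses [P] at the root, which the root's test equates with
   $F(r)\sigma$. *)
have := sum_local local; rewrite big_split /= -scaler_suml sum_contribution.
have /and3P[_ _ /andP[_ /eqP]] := acc root.
rewrite eqxx -/(tr root) chalE tr_msg_transcript // => -> E.
by rewrite /discrepancy scalerBl E opprD addrA subrr add0r.
Qed.

Hypothesis q_pr : prime q.
Hypothesis no : ~ yes_instance I.

(** By the sumcheck bound the discrepancy vanishes for at most $N d q^{N-1}$ choices of the points,
    each counted with all $q^t$ vectors [sigma]; every other choice admits at most one [sigma]. *)
Lemma card_accept :
  (#|[set x : chal | discrepancy x.1 *: x.2 == - mask_sum]|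
     <= N * d * q ^ N.-1 * q ^ t + q ^ N)%N.
Proof.
rewrite -sum1dep_card (eq_bigl (fun x : chal => discrepancy (x.1, x.2).1 *: (x.1, x.2).2
  == - mask_sum)); last by case.
rewrite -(pair_big_dep xpredT (fun (r : N.-tuple F) (s : 'rV[F]_t) =>
  discrepancy r *: s == - mask_sum) (fun _ _ => 1%N)) /=.
apply: leq_trans (_ : \sum_(r : N.-tuple F)
  ((discrepancy r == 0%R) * q ^ t + 1) <= _)%N.
  apply: leq_sum => r _; rewrite sum1dep_card.
  have [_|D0] := eqVneq (discrepancy r) 0.
    by rewrite mul1n -(card_rV q_pr t) (leq_trans (max_card _)) ?leq_addr.
  rewrite mul0n add0n.
  apply: leq_trans (_ : #|[set (discrepancy r)^-1 *: - mask_sum]| <= _)%N; last by rewrite cards1.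
  apply: subset_leq_card; apply/subsetP => s; rewrite !inE => /eqP <-.
  by rewrite scalerA mulVf // scale1r.
rewrite big_split /= -big_distrl /= sum1_card card_tuple card_Fp // leq_add2r leq_mul2r.
apply/orP; right.
have deg : individual_degree_le d (poly_F I) := @degree_F _ _ _ _ I.
have := @sumcheck_sound_card _ d N (partial_sum (poly_F I)) (partial_poly (poly_F I)) d_gt0
  (size_partial_poly deg) (fun s z _ => partial_poly_horner (poly_F I) s z)
  (@partial_poly_sum _ _ (poly_F I)) committed_poly N [::] (target I) size_committed_poly.
rewrite -cube_sumE card_Fp // => /(_ erefl); rewrite eq_sym => /(_ (introN eqP no)).
apply: leq_trans; apply: leq_sum => r _.
by rewrite /discrepancy subr_eq0 partial_sum_full ?size_tuple.
Qed.

End Soundness.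

Lemma ip_history_transcript (N d q t c n : nat) (I : instance N d q n)
    (P : prover n (msg_bits q t c)) (w : ip_sample (Pi := main_dIP N d q t c) I P) (m : nat) :
  (m <= N.*2.+1)%N ->
  ip_history w m =
    transcript I P w.2 (of_coin (challenge0 N q t) (w.1.1 (tree_root I))) m.
Proof.
elim: m => //= m IHm ltm; rewrite -IHm 1?ltnW //; congr rcons.
rewrite /prover_turn oddB ?(ltnW ltm) //= odd_double /=; case: (odd m) => //=.
apply/ffunP => v; rewrite !ffunE /main_msg size_map.
have -> : size (ip_history w m) = m.
  by elim: (m) => //= m' IHm'; rewrite size_rcons IHm'.
rewrite is_root /=; case: eqP => // v0.
by have -> : v = tree_root I by apply: val_inj.
Qed.

Lemma main_dIP_accept (N d q t c n : nat) (I : instance N d q n)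
    (P : prover n (msg_bits q t c)) (w : ip_sample (Pi := main_dIP N d q t c) I P) :
    prime q -> (0 < N)%N ->
  let x := of_coin (challenge0 N q t) (w.1.1 (tree_root I)) in
  let tr v := [seq m v | m : {ffun _ -> _} <- transcript I P w.2 x N.*2.+1] in
  all_accept w = [forall v, node_check d (tr v)
       (input I v) (if v == tree_root I then nat_of_ord (enum_rank x) else 0%N)
       [seq tr_report N (tr u) | u <- enum 'I_n & parent I u == Some v]
       (if v == tree_root I then eval_seq (poly_F I) (tr_challenge N (tr v)).1 else 0)].
Proof.
move=> q_pr N_gt0 x tr; apply: eq_forallb => v.
rewrite main_verif_output //= /ip_transcript ip_history_transcript //.
congr node_check.
  rewrite of_coinK; last by have := ltn_ord (w.1.1 (tree_root I)).
  case: eqVneq => [->//|neq].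
  (* The coin of a node other than the root can only be 0. *)
  have ord1E m (j : 'I_m.+1) : m = 0%N -> j = 0%N :> nat.
    by move=> m0; apply/eqP; rewrite -leqn0 -m0 -ltnS.
  by apply: ord1E; rewrite /= /main_coins /= ifN.
Qed.

Lemma main_dIP_sound (N d q t c n : nat) (I : instance N d q n)
    (P : prover n (msg_bits q t c)) : prime q -> (0 < N)%N -> (0 < d)%N -> (0 < t)%N ->
  ~ yes_instance I ->
  accept_prob (Pi := main_dIP N d q t c) I P <= (N * d)%:R / q%:R + t%:R^-1.
Proof.
move=> q_pr N_gt0 d_gt0 t_gt0 no.
pose good (y : challenge N q t * 'I_(pr_coins P).+1) :=
  discrepancy I P y.2 y.1.1 *: y.1.2 == - mask_sum I P y.2.
pose get (w : ip_sample (Pi := main_dIP N d q t c) I P) :=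
  (of_coin (challenge0 N q t) (w.1.1 (tree_root I)), w.2).
have getU : uniform_map get.
  have cE : main_coins N t (input I (tree_root I)) = #|challenge N q t|.-1 by [].
  pose put (w : ip_sample (Pi := main_dIP N d q t c) I P)
    (y : challenge N q t * 'I_(pr_coins P).+1) : ip_sample (Pi := main_dIP N d q t c) I P :=
    (set_coin (challenge0 N q t) cE w.1.1 y.1, w.1.2, y.2).
  have w0 : ip_sample (Pi := main_dIP N d q t c) I P :=
    ([ffun u => ord0], [ffun u => ord0], ord0).
  apply: (uniform_lens (put := put) w0) => [w [y k]|[[w1 w2] k] y].
    by rewrite /get /= set_coinK.
  by rewrite /put /get /= set_coin_id.
apply: le_trans (_ : prob (fun w => good (get w)) <= _).
  apply: prob_le => w; rewrite main_dIP_accept // => /forallP acc.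
  by apply/eqP; apply: accept_discrepancy.
rewrite getU; apply: prob_pair_le => [|k]; first by rewrite addr_ge0 ?divr_ge0 ?invr_ge0 ?ler0n.
have q_gt0 : 0 < q%:R :> rat by rewrite ltr0n prime_gt0.
rewrite /prob card_challenge // ler_pdivrMr ?ltr0n ?expn_gt0 ?prime_gt0 //.
apply: le_trans (_ : (N * d * q ^ N.-1 * q ^ t + q ^ N)%:R <= _).
  by rewrite ler_nat; apply: card_accept.
rewrite natrD mulrDl expnD lerD //.
  rewrite (_ : q ^ N = q * q ^ N.-1)%N; last by rewrite -expnS prednK.
  by rewrite [leRHS](_ : _ = (N * d * q ^ N.-1 * q ^ t)%:R) // !natrM; field; rewrite lt0r_neq0.
rewrite natrM mulrCA -[leLHS]mulr1 ler_wpM2l ?ler0n //.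
rewrite mulrC ler_pdivlMr ?ltr0n // mul1r ler_nat.
(* What is left is [t <= q ^ t], true because $q \ge 2$. *)
by rewrite ltnW // ltn_expl // prime_gt1.
Qed.

(** * Completeness *)

Section Honest.

Variables (N d q t c n : nat) (I : instance N d q n).
Hypothesis q_pr : prime q.
Hypothesis N_gt0 : (0 < N)%N.

Local Notation F := 'F_q.
Local Notation B := c.*2.+1.
Local Notation chal := (challenge N q t).
Local Notation root := (tree_root I).
Local Notation coin := (prover_coin N q t c n).

(** The honest prover can form message [i] in time: it involves the first [i] points, and [sigma]
    only if [i = N]. *)
Lemma honest_msg_take (w : coin) (r : N.-tuple F) (s s' : 'rV[F]_t) (v : 'I_n) (i : nat) :
  (i <= N)%N -> (i = N -> s' = s) ->
  honest_msg I w (take i r) s' v i = honest_msg I w r s v i.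
Proof.
move=> leiN E; rewrite /honest_msg /prover_msg take_takel //.
have -> : (0 :: take i r)`_i = (0 :: (r : seq F))`_i.
  by case: i {leiN E} => //= i; rewrite nth_take.
by case: eqP => // iN; rewrite E // take_oversize // iN size_tuple.
Qed.

Lemma transcript_honest (x : chal) (k m : nat) : (m <= N.*2.+1)%N ->
  transcript I (main_prover t c I) k x m =
    mkseq (fun j => [ffun v => bits_of (msg_bits q t c)
      (if odd j then (if v == root then verifier_msg c x j./2 else msg0 q t c)
       else honest_msg I (of_coin (prover_coin0 N q t c n) k) x.1 x.2 v j./2)]) m.
Proof.
elim: m => // m IHm ltm; rewrite mkseqS /= IHm 1?ltnW //; congr rcons.
case om: (odd m); apply/ffunP => v; rewrite !ffunE //; congr bits_of.
rewrite size_mkseq; set h := mkseq _ m.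
have mE j : (j < m./2)%N ->
    decode q t c (nth [ffun=> [tuple of nseq _ false]] h j.*2.+1 root) = verifier_msg c x j.
  move=> ltj; rewrite nth_mkseq; last by move: om; lia.
  by rewrite ffunE /= odd_double /= ?eqxx uphalf_double decodeK.
have -> : mkseq (fun j => msg_point
    (decode q t c (nth [ffun=> [tuple of nseq _ false]] h j.*2.+1 root))) m./2 = take m./2 x.1.
  have sz : size (take m./2 x.1) = m./2 by rewrite size_takel // size_tuple; lia.
  apply: (@eq_from_nth _ 0); rewrite size_mkseq ?sz // => j ltj.
  by rewrite nth_mkseq // mE // nth_take.
apply: honest_msg_take => [|mN]; first by lia.
by rewrite mN mE ?mN ?prednK // /verifier_msg eqxx.
Qed.

Definition honest_transcript (x : chal) (k : nat) (v : 'I_n) :=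
  [seq m v | m : {ffun _ -> _} <- transcript I (main_prover t c I) k x N.*2.+1].

Section FixCoins.

Variables (x : chal) (k : nat).
Local Notation w := (of_coin (prover_coin0 N q t c n) k).

Lemma tr_msg_honest (v : 'I_n) (i : nat) : (i <= N)%N ->
  tr_msg (honest_transcript x k v) i = honest_msg I w x.1 x.2 v i.
Proof.
move=> leiN; have lti : (i.*2 < N.*2.+1)%N by rewrite ltnS leq_double.
rewrite /tr_msg /honest_transcript transcript_honest //.
rewrite (nth_map [ffun=> [tuple of nseq _ false]]) ?size_mkseq //.
by rewrite nth_mkseq // ffunE odd_double doubleK decodeK.
Qed.

Lemma tr_challenge_honest (v : 'I_n) : tr_challenge N (honest_transcript x k v) = x.
Proof.
case: x (tr_msg_honest v) => r s E; rewrite /tr_challenge; congr (_, _).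
  by apply: eq_from_tnth => i; rewrite tnth_mktuple E // (tnth_nth 0).
by rewrite E // /honest_msg /prover_msg eqxx.
Qed.

Lemma tr_P_honest (v : 'I_n) :
  msg_P (tr_msg (honest_transcript x k v) N) = honest_P I w x.1 x.2 v.
Proof. by rewrite tr_msg_honest // /honest_msg /prover_msg eqxx. Qed.

Lemma tr_contribution_honest (v : 'I_n) :
  tr_contribution N d (honest_transcript x k v) v (target I)
    = honest_contribution I w x.1 v.
Proof.
rewrite /tr_contribution tr_challenge_honest; apply: eq_chain => i.
by rewrite size_tuple => ltiN; rewrite tr_msg_honest // ltnW.
Qed.

End FixCoins.

Lemma honest_P_local (w : coin) (r : seq F) (s : 'rV[F]_t) (v : 'I_n) :
  honest_P I w r s v = honest_contribution I w r v *: s + honest_K I w v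
    + children_sum I (honest_P I w r s) v.
Proof.
rewrite /honest_P /honest_K subtree_sumE /children_sum big_split /= -scaler_suml scalerDl.
by rewrite [X in _ = X + _]addrA subrKA addrA [X in X + _ = _]addrC.
Qed.

Lemma rVpoly_poly_rV (m : nat) (p : {poly F}) : rVpoly (poly_rV p : 'rV_m) = take_poly m p.
Proof.
apply/polyP => i; rewrite coef_rVpoly coef_take_poly; case: insubP => [j _ <-|/negPf -> //].
by rewrite mxE ltn_ord.
Qed.

Lemma sum_blocks (b m : nat) (p : {poly F}) :
  \sum_(v < m) 'X^(b * v) * take_poly b (drop_poly (b * v) p) = take_poly (b * m) p.
Proof.
elim: m => [|m IHm]; first by rewrite big_ord0 muln0 take_poly0l.
rewrite big_ord_recr /= IHm; apply/polyP => i.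
rewrite coefD !coef_take_poly coefXnM coef_take_poly coef_drop_poly.
case: (ltnP i (b * m)) => [lti|lei].
  by rewrite (leq_trans lti) ?leq_mul2l ?leqnSn ?orbT ?addr0.
by rewrite add0r ltn_subLR // -mulnSr subnK.
Qed.

Hypothesis d_le : (d <= c * n)%N.

Lemma sum_share_poly (w : coin) (s : seq F) : (size s < N)%N ->
  \sum_(v < n) share_poly d v (share I w v s) = partial_poly (poly_F I) s.
Proof.
move=> lts; have n0 := n_gt0 I; set p := partial_poly _ _.
have sp : (size p <= d.+1)%N by apply: size_partial_poly => //; apply: (@degree_F _ _ _ _ I).
(* Node [v] adds the blinding [A v] received for block $v-1$ and subtracts [A v.+1], so the
   blindings telescope. *)
pose A k : {poly F} := if k is k'.+1 then
  'X^(B * k') * rVpoly (w.1 (Ordinal lts, inord k)) else 0.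
have n1 : (n == 1%N) -> forall v : 'I_n, v = 0%N :> nat.
  by move=> /eqP E v; have := ltn_ord v; lia.
have shareE (v : 'I_n) : share_poly d v (share I w v s) =
    take_poly d.+1 ('X^(B * v) * take_poly B (drop_poly (B * v) p)) +
    take_poly d.+1 (if n == 1%N then 0 else A v - A v.+1).
  rewrite /share_poly /share insubT /= -take_polyD; congr take_poly.
   have -> : widen_ord (leqnSn n) v = inord v by apply: val_inj; rewrite /= inordK // ltnS ltnW.
  have -> : lift ord0 v = inord v.+1 by apply: val_inj; rewrite /= inordK // ltnS.
  rewrite raddfB /= rVpoly_poly_rV mulrBr /A.
  case: ifP => [/n1 ->|_]; first by rewrite raddf0 mulr0 add0r subr0 addr0.
  by rewrite addrCA.
under eq_bigr do rewrite shareE.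
rewrite big_split -!take_poly_sum sum_blocks.
have -> : take_poly (B * n) p = p by rewrite take_poly_id // (leq_trans sp) //; nia.
rewrite (take_poly_id sp).
rewrite -[RHS]addr0; congr (_ + _).
case: eqP => [_|/eqP n_neq1]; first by rewrite big1 ?take_poly0r.
rewrite -(big_mkord xpredT (fun v => A v - A v.+1)).
rewrite (eq_bigr (fun v => - (A v.+1 - A v))) => [|v _]; last by rewrite opprB.
rewrite sumrN telescope_sumr // subr0.
(* The last blinding is not cancelled, but it starts at degree $(2c+1)(n-1)$, which exceeds $cn \ge
   d$ for $n \ge 2$, and is truncated. This fixes the block length. *)
have -> : A n = 'X^(B * n.-1) * rVpoly (w.1 (Ordinal lts, inord n)).
  by rewrite -[in LHS](prednK n0) /A prednK.
apply/polyP => i; rewrite coef0 coef_take_poly coefN coefXnM.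
case: ifP => // lti; case: ifP => [_|]; first by rewrite oppr0.
by move/negP; case; nia.
Qed.

Lemma sum_honest_contribution (w : coin) (r : N.-tuple F) : (0 < d)%N ->
  yes_instance I -> \sum_v honest_contribution I w r v = eval_seq (poly_F I) r.
Proof.
move=> d_gt0 yes; rewrite chain_sum -big_mkcond /= (big_pred1 root) //.
rewrite -[target I]yes cube_sumE -partial_sum_full ?size_tuple //.
rewrite -[partial_sum (poly_F I) r]/(partial_sum (poly_F I) ([::] ++ r)).
rewrite -(@sumcheck_complete _ N _ (partial_poly (poly_F I))) ?size_tuple //.
- apply: eq_chain => i; rewrite size_tuple => ltiN.
  by rewrite sum_share_poly // size_takel // size_tuple // ltnW.
- by move=> s z _; apply: partial_poly_horner.
- exact: partial_poly_sum.
Qed.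

Lemma honest_P_root (w : coin) (r : N.-tuple F) (s : 'rV[F]_t) : (0 < d)%N ->
  yes_instance I -> honest_P I w r s root = eval_seq (poly_F I) r *: s.
Proof.
move=> d_gt0 yes; rewrite /honest_P /mask_of eqxx add0r.
by rewrite (sum_local (subtree_sumE I (honest_contribution I w r))) sum_honest_contribution.
Qed.

Lemma main_dIP_complete : (0 < d)%N -> yes_instance I ->
  accept_prob I (ip_honest (main_dIP N d q t c) I) = 1.
Proof.
move=> d_gt0 yes.
have w0 : ip_sample I (ip_honest (main_dIP N d q t c) I) :=
  ([ffun u => ord0], [ffun u => ord0], ord0).
apply: (prob1 w0) => w; rewrite main_dIP_accept //; apply/forallP => v.
set x := of_coin _ _; set tr := fun u : 'I_n => honest_transcript x w.2 u.
suff: node_check d (tr v) (input I v) (if v == root then nat_of_ord (enum_rank x) else 0%N)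
    [seq tr_report N (tr u) | u <- enum 'I_n & parent I u == Some v]
    (if v == root then eval_seq (poly_F I) (tr_challenge N (tr v)).1 else 0) by [].
apply/and3P; split.
- by apply/allP => m /mapP[u _ ->]; rewrite /= !tr_challenge_honest.
- rewrite tr_P_honest tr_contribution_honest tr_challenge_honest honest_P_local.
  rewrite big_map big_filter big_enum_cond /= tr_msg_honest //; apply/eqP.
  by congr (_ + _); apply: eq_bigr => u _; rewrite tr_P_honest.
- apply/implyP => v0; have -> : v = root by apply/eqP.
  by rewrite eqxx tr_challenge_honest tr_P_honest enum_rankK_coin honest_P_root ?eqxx.
Qed.

End Honest.

(** * Zero knowledge *)

Lemma extendE (V : zmodType) (m : nat) (f : {ffun 'I_m -> V}) (j : 'I_m) :
  extend f j = f j.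
Proof. by rewrite /extend valK. Qed.

Section ZeroKnowledge.

Variables (N d q t c n : nat) (I : instance N d q n) (v : 'I_n).
Hypothesis q_pr : prime q.
Hypothesis N_gt0 : (0 < N)%N.
Hypothesis d_gt0 : (0 < d)%N.
Hypothesis d_le : (d <= c * n)%N.
Hypothesis n_neq1 : n != 1%N.
Hypothesis yes : yes_instance I.

Local Notation F := 'F_q.
Local Notation B := c.*2.+1.
Local Notation chal := (challenge N q t).
Local Notation root := (tree_root I).
Local Notation coin := (prover_coin N q t c n).
Local Notation view_coin := (sim_coin N t c (input I v)).

Definition neighbours : seq 'I_n := [seq u <- enum 'I_n | adj I v u].

Lemma mem_neighbours (u : 'I_n) : (u \in neighbours) = adj I v u.
Proof. by rewrite mem_filter mem_enum andbT. Qed.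

Definition at_neighbour (V : zmodType)
  (f : {ffun 'I_(size (li_neighbours (input I v))) -> V}) (u : 'I_n) : V :=
  extend f (index (val u) (li_neighbours (input I v))).

Definition tabulate (V : zmodType) (g : 'I_n -> V) :
    {ffun 'I_(size (li_neighbours (input I v))) -> V} :=
  [ffun k => g (nth v neighbours (nat_of_ord k))].

Lemma at_tabulate (V : zmodType) (g : 'I_n -> V) (u : 'I_n) :
  adj I v u -> at_neighbour (tabulate g) u = g u.
Proof.
rewrite -mem_neighbours => uN; rewrite /at_neighbour /= (index_map val_inj) -/neighbours.
have lti : (index u neighbours < size [seq val u | u <- neighbours])%N.
  by rewrite size_map index_mem.
by rewrite (extendE _ (Ordinal lti)) ffunE nth_index.
Qed.

Lemma tabulate_at (V : zmodType) (f : {ffun 'I_(size (li_neighbours (input I v))) -> V}) :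
  tabulate (at_neighbour f) = f.
Proof.
apply/ffunP => k; rewrite ffunE /at_neighbour /= (index_map val_inj) -/neighbours.
have := ltn_ord k; rewrite [X in (_ < X)%N -> _]size_map => ltk.
have uN : uniq neighbours by rewrite filter_uniq ?enum_uniq.
by rewrite index_uniq // extendE.
Qed.

(* The view does not depend on the values at non-children; taking their masks
   makes [get_view] uniform. *)
Definition shown_P (x : chal) (w : coin) (u : 'I_n) : 'rV[F]_t :=
  if parent I u == Some v then honest_P I w x.1 x.2 u else w.2 u.

(** At the root [K] is determined by $F(r)\sigma$ and the rest of the view; the free coin [w.2 v]
    takes its slot, and [sim_view] recomputes [K]. *)
Definition get_view (y : chal * coin) : view_coin :=
  let: (x, w) := y in
  (x, [ffun i : 'I_N => share I w v (take i x.1)],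
   (if v == root then w.2 v else honest_K I w v, tabulate (shown_P x w))).

(** Solves [share] at node [v] for the two blinding vectors, of indices $v$ and $v+1$, that enter
    its messages. *)
Definition put_blocks (w : {ffun 'I_N * 'I_n.+1 -> 'rV[F]_B}) (r : seq F)
    (ys : {ffun 'I_N -> block_pair q c}) : {ffun 'I_N * 'I_n.+1 -> 'rV[F]_B} :=
  [ffun ik : 'I_N * 'I_n.+1 => if ik.2 == v :> nat then (ys ik.1).1
    else if ik.2 == v.+1 :> nat then
      poly_rV (drop_poly (B * v) (partial_poly (poly_F I) (take ik.1 r))) - (ys ik.1).2
    else w ik].

Definition put_mask (x : chal) (w : coin)
    (f : {ffun 'I_(size (li_neighbours (input I v))) -> 'rV[F]_t}) (u : 'I_n) : 'rV[F]_t :=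
  at_neighbour f u -
    if parent I u == Some v then subtree_sum I (honest_contribution I w x.1) u *: x.2 else 0.

(** Solves for the masks of the neighbours first, and then for the node's own mask, which [K]
    determines given those of the children. *)
Definition put_masks (x : chal) (w : coin) (K : 'rV[F]_t)
    (f : {ffun 'I_(size (li_neighbours (input I v))) -> 'rV[F]_t}) :
    {ffun 'I_n -> 'rV[F]_t} :=
  [ffun u => if adj I v u then put_mask x w f u
    else if u == v then
      if v == root then K else K + children_sum I (put_mask x w f) v
    else w.2 u].

Definition put_view (y : chal * coin) (z : view_coin) : chal * coin :=
  let: (_, w) := y in
  let: (x, ys, (K, f)) := z in
  let w1 := put_blocks w.1 x.1 ys in
  (x, (w1, put_masks x (w1, w.2) K f)).

Lemma child_mask (w : coin) (u u' : 'I_n) : parent I u = Some u' -> mask_of I w u = w.2 u.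
Proof. by move=> uv; rewrite /mask_of -parent_eq_none uv. Qed.

Lemma size_take_chal (x : chal) (i : 'I_N) : size (take i x.1) = i.
Proof. by rewrite size_takel // size_tuple ltnW. Qed.

Lemma get_put (y : chal * coin) (z : view_coin) : get_view (put_view y z) = z.
Proof.
case: y => x0 w; case: z => [[x ys] [K f]] /=.
have nbr_child u : parent I u = Some v -> adj I v u by move/eqP/in_adj.
congr (_, _, (_, _)).
- apply/ffunP => i; rewrite ffunE /share size_take_chal valK !ffunE /= eqxx (negPf n_neq1).
  by rewrite -lift0 gtn_eqF /= ?lift0 // eqxx subKr -surjective_pairing.
- case: (eqVneq v root) => [v0|v0]; first by rewrite ffunE adj_irr eqxx v0 eqxx.
  rewrite /honest_K /mask_of (negPf v0) ffunE adj_irr eqxx (negPf v0).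
  rewrite -addrA [X in _ + X](_ : _ = 0) ?addr0 //.
  rewrite /children_sum -sumrB big1 // => u /eqP uv.
  by rewrite -parent_eq_none uv /= ffunE nbr_child // subrr.
- rewrite -[RHS]tabulate_at; apply/ffunP => k; rewrite !ffunE.
  set u := nth _ _ _; have uN : adj I v u.
    rewrite -mem_neighbours mem_nth // (leq_trans (ltn_ord k)) //.
    by rewrite [leqLHS]size_map.
  rewrite /shown_P; case: eqP => [uv|]; last first.
    by move/eqP/negPf=> nc; rewrite ffunE uN /put_mask nc subr0.
  by rewrite /honest_P (child_mask _ uv) ffunE uN /put_mask uv eqxx subrK.
Qed.

Lemma put_get (y : chal * coin) (z : view_coin) : put_view (put_view y z) (get_view y) = y.
Proof.
case: y => x [w1 w2]; case: z => [[x' ys] [K f]] /=.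
have nbr_child u : parent I u = Some v -> adj I v u by move/eqP/in_adj.
set w1' := put_blocks w1 _ _; set w1'' := put_blocks w1' _ _.
(* The blocks are restored before the masks, since the latter are recovered by means of subtree sums
   that depend on the blocks. *)
have w1E : w1'' = w1.
  apply/ffunP => -[i k]; rewrite !ffunE /share /= size_take_chal valK /= (negPf n_neq1).
  case: eqP => [kv|kv]; first by congr (w1 (_, _)); apply: val_inj.
  case: eqP => [kv'|//]; rewrite opprB addrC subrK.
  by congr (w1 (_, _)); apply: val_inj; rewrite [RHS]kv'.
rewrite w1E; congr (_, (_, _)).
have maskE u : adj I v u -> put_mask x (w1, put_masks x' (w1', w2) K f)
    (tabulate (shown_P x (w1, w2))) u = w2 u.
  move=> uN; rewrite /put_mask at_tabulate // /shown_P; case: eqP => [uv|_]; last by rewrite subr0.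
  by rewrite /honest_P (child_mask _ uv) addrK.
apply/ffunP => u; rewrite ffunE; case: ifP => [uN|uN]; first exact: maskE.
case: (eqVneq u v) => [->|neq]; last by rewrite ffunE uN (negPf neq).
case: (eqVneq v root) => [//|v0].
rewrite /honest_K {1}/mask_of (negPf v0) -addrA [X in _ + X](_ : _ = 0) ?addr0 //.
rewrite addrC /children_sum -sumrB big1 // => u' /eqP uv.
by rewrite maskE ?nbr_child // (child_mask _ uv) subrr.
Qed.

Lemma uniform_get_view : uniform_map get_view.
Proof.
exact: (uniform_lens (challenge0 N q t, prover_coin0 N q t c n) get_put put_get).
Qed.

Lemma mask_prover_turn (T : Type) (g : nat -> T) (m : nat) :
  mask (mkseq (prover_turn m.*2.+1) m.*2.+1) (mkseq g m.*2.+1) = mkseq (fun i => g i.*2) m.+1.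
Proof.
rewrite /mkseq -map_mask -filter_mask (@eq_in_filter _ _ (fun j => ~~ odd j)); last first.
  move=> j; rewrite mem_iota /= add0n => ltj.
  by rewrite /prover_turn oddB ?(ltnW ltj) //= odd_double.
rewrite (_ : [seq j <- _ | _] = [seq i.*2 | i <- iota 0 m.+1]); first by rewrite -map_comp.
elim: m => // m IHm; rewrite doubleS -[m.*2.+3]addn2 iotaD filter_cat IHm.
by rewrite -[in RHS](addn1 m.+1) iotaD map_cat /= odd_double.
Qed.

Definition sim_box : seq (nat * bool) :=
  [seq (val u, parent I u == Some v) | u <- enum 'I_n & adj I v u].

Definition sim_eval (z : view_coin) : F :=
  if v == root then eval_seq (poly_F I) z.1.1.1 else 0.

Definition sample_coins (w : ip_sample I (ip_honest (main_dIP N d q t c) I)) : chal * coin :=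
  (of_coin (challenge0 N q t) (w.1.1 root), of_coin (prover_coin0 N q t c n) w.2).

Lemma uniform_sample_coins : uniform_map sample_coins.
Proof.
have cE : main_coins N t (input I root) = #|chal|.-1 by [].
pose put (w : ip_sample I (ip_honest (main_dIP N d q t c) I)) (y : chal * coin) :
    ip_sample I (ip_honest (main_dIP N d q t c) I) :=
  (set_coin (challenge0 N q t) cE w.1.1 y.1, w.1.2,
   Ordinal (coin_ltn (prover_coin0 N q t c n) y.2 erefl)).
have w0 : ip_sample I (ip_honest (main_dIP N d q t c) I) :=
  ([ffun u => ord0], [ffun u => ord0], ord0).
apply: (uniform_lens (put := put) w0) => [w [y k]|[[w1 w2] k] y].
  by rewrite /sample_coins /= set_coinK enum_rankK_coin.
rewrite /put /sample_coins /= set_coin_id; congr (_, _).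
by apply: val_inj; rewrite /= of_coinK.
Qed.

(** The view is a function of the uniform data in [get_view]: [P] follows from the tree equation,
    and at the root $P = F(r)\sigma$ on a yes-instance gives [K]. *)
Lemma view_honest (w : ip_sample I (ip_honest (main_dIP N d q t c) I)) :
  let z := get_view (sample_coins w) in
  view w v = sim_view d z sim_box (sim_eval z).
Proof.
set y := sample_coins w => z.
have histE u : ip_transcript w u = honest_transcript c I y.1 w.2 u.
  by rewrite /ip_transcript ip_history_transcript.
have shareE i : extend [ffun i : 'I_N => share I y.2 v (take i y.1.1)] i
    = share I y.2 v (take i y.1.1).
  case: (ltnP i N) => [lti|leNi]; first by rewrite (extendE _ (Ordinal lti)) ffunE.
  rewrite /extend insubF; last by rewrite ltnNge leNi.
  by rewrite /share take_oversize ?size_tuple // insubF // ltnn.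
have contrE : contribution d v (target I)
    (extend [ffun i : 'I_N => share I y.2 v (take i y.1.1)]) y.1.1
    = honest_contribution I y.2 y.1.1 v.
  by apply: eq_chain => i _; rewrite shareE.
have atP u : adj I v u -> at_neighbour (tabulate (shown_P y.1 y.2)) u = shown_P y.1 y.2 u.
  exact: at_tabulate.
have sumE : \sum_(m <- sim_box | m.2)
    extend (tabulate (shown_P y.1 y.2)) (index m.1 (li_neighbours (input I v)))
    = children_sum I (honest_P I y.2 y.1.1 y.1.2) v.
  rewrite big_map sum_children_nbrs; apply: eq_bigr => u uv.
  rewrite -/(at_neighbour (tabulate (shown_P y.1 y.2)) u) atP /shown_P ?uv //.
  exact: in_adj uv.
have zE : z = (y.1, [ffun i : 'I_N => share I y.2 v (take i y.1.1)],
    (if v == root then y.2.2 v else honest_K I y.2 v, tabulate (shown_P y.1 y.2))).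
  by rewrite /z; case: (y).
have localP := honest_P_local I y.2 y.1.1 y.1.2 v.
have evalE : v == root -> sim_eval z *: y.1.2 = honest_P I y.2 y.1.1 y.1.2 v.
  move=> v0; transitivity (eval_seq (poly_F I) y.1.1 *: y.1.2).
    by rewrite /sim_eval v0 zE.
  have -> : honest_P I y.2 y.1.1 y.1.2 v = honest_P I y.2 y.1.1 y.1.2 root.
    by congr honest_P; apply/eqP.
  by rewrite honest_P_root.
rewrite zE /sim_view contrE sumE -zE; set K := if _ then _ else _.
have KE : K = honest_K I y.2 v.
  rewrite /K -[li_id _ == _]/(v == root); case: ifP => [/evalE ->|-> //].
  by rewrite localP [X in X - _]addrAC addrC addrK.
rewrite KE [_ + honest_K _ _ _]addrAC -localP /view; congr (_, _).
  rewrite histE /= /honest_transcript transcript_honest // /mkseq -map_comp mask_prover_turn.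
  apply: eq_mkseq => i; rewrite /= ffunE odd_double doubleK /honest_msg.
  by congr bits_of; rewrite /prover_msg shareE.
rewrite main_verif_received -[in RHS]map_comp; congr [:: _]; apply/eq_in_map => u.
rewrite mem_filter /= => /andP[uN _]; congr (_, _); case: ifP => // uv.
rewrite -/(at_neighbour (tabulate (shown_P y.1 y.2)) u) atP // /shown_P uv /tr_report.
by rewrite histE tr_challenge_honest // tr_P_honest.
Qed.

Lemma main_dIP_zero_knowledge :
  tvdist (@sim_output N d q n (main_dIP N d q t c) (main_sim N d q t c) I v)
         (fun w : ip_sample I (ip_honest (main_dIP N d q t c) I) => view w v) = 0.
Proof.
apply: tvdist_eq0 => y.
pose A (z : view_coin) := sim_view d z sim_box (sim_eval z) == y.
transitivity (prob A).
  have cE : alg_coins (main_sim N d q t c) (input I v) = #|view_coin|.-1 by [].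
  rewrite -(uniform_coin (sim_coin0 N t c (input I v)) cE A).
  congr (_%:R / _); apply: eq_card => w; rewrite !inE /A.
  by rewrite main_sim_output.
rewrite -(uniform_comp uniform_sample_coins uniform_get_view A).
by congr (_%:R / _); apply: eq_card => w; rewrite !inE /A -view_honest.
Qed.

End ZeroKnowledge.

(** * The case [N * d = 0] *)

Section Trivial.

Variables (N d q : nat).

Definition trivial_verif : dist_alg N q (nat * seq (0.-tuple bool)) bool :=
  @DistAlg N q (nat * seq (0.-tuple bool)) bool 0 0 (fun=> 0%N) bool
    (fun li _ _ =>
       if li_id li == 0%N then
         Query (fun=> 0) (fun y => Return _ _ (y *+ 2 ^ N == li_target li))
       else Return _ _ true)
    (fun _ _ _ => [bseq]) (fun _ st _ => Return _ _ st) id.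

(** There is no interaction at all, as a bound proportional to $N$ demands when $N = 0$. *)
Definition trivial_dIP : dIP N d q :=
  @DIP N d q 0 0 (fun=> 0%N) (fun _ _ _ => [tuple]) trivial_verif
    (fun n _ => @Prover n 0 0 (fun _ _ => [ffun=> [tuple]])).

Definition trivial_sim : simulator trivial_dIP :=
  @DistAlg N q unit (view_type trivial_dIP) 0 0 (fun=> 0%N) unit
    (fun _ _ _ => Return _ _ tt) (fun _ _ _ => [bseq]) (fun _ _ _ => Return _ _ tt)
    (fun=> ([::], [::])).

Variables (n : nat) (I : instance N d q n).
Hypothesis Nd0 : (N * d == 0)%N.

Lemma trivial_accept (P : prover n (ip_bits trivial_dIP)) (w : ip_sample I P) :
  all_accept w = (cube_sum (poly_F I) == target I).
Proof.
rewrite (cube_sum_const (@degree_F _ _ _ _ I)) //; apply/forallP/idP => [/(_ (tree_root I))//|ok v].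
by rewrite /alg_output /=; case: ifP.
Qed.

Lemma trivial_queries (x : 'I_n -> nat * seq (0.-tuple bool))
    (w : node_coins I (alg_coins trivial_verif)) : (alg_queries x w <= 1)%N.
Proof.
rewrite /alg_queries (bigD1 (tree_root I)) //= big1 ?addn0 => [|v] //.
by rewrite is_root => /negPf /=; case: ifP => /eqP // ->.
Qed.

Lemma trivial_sim_queries (x : 'I_n -> unit)
    (w : node_coins I (alg_coins trivial_sim)) : (alg_queries x w <= 1)%N.
Proof. by rewrite /alg_queries big1. Qed.

Lemma trivial_zero_knowledge (v : 'I_n) :
  tvdist (@sim_output N d q n trivial_dIP trivial_sim I v)
         (fun w : ip_sample I (ip_honest trivial_dIP I) => view w v) = 0.
Proof.
have w1 : node_coins I (alg_coins trivial_sim) := [ffun u => ord0].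
have w2 : ip_sample I (ip_honest trivial_dIP I) := ([ffun u => ord0], [ffun u => ord0], ord0).
have probb (T : finType) (x0 : T) (A : pred T) (b : bool) : (forall x, A x = b) -> prob A = b%:R.
  case: b => AE; first exact: (prob1 x0).
  by rewrite /prob (_ : [set _ | _] = set0) ?cards0 ?mul0r //; apply/setP => x; rewrite !inE.
have received w : view (P := ip_honest trivial_dIP I) w v = ([::], [::]).
  by rewrite /view /alg_received /=; case: ifP.
apply: tvdist_eq0 => y; rewrite (probb _ w1 _ (([::], [::]) == y)) //.
by rewrite (probb _ w2 _ (([::], [::]) == y)) // => w; rewrite received.
Qed.

End Trivial.

(** * Choice of the protocol and proof of the theorem *)

Definition protocol (t c N d q : nat) : {Pi : dIP N d q & simulator Pi} :=
  if (N * d == 0)%N then existT _ _ (trivial_sim N d q)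
  else existT _ _ (main_sim N d q t c).

Theorem theorem1 (t c : nat) (t_gt0 : (0 < t)%N) :
  exists (Pi : forall N d q : nat, dIP N d q)
         (S : forall N d q : nat, simulator (Pi N d q)) (C : nat),
  [/\ forall (N d q : nat), prime q ->
        [/\ (ip_rounds (Pi N d q) <= C * N)%N,
            (ip_bits (Pi N d q) <= C * up_log 2 q)%N,
            in_class (ip_verif (Pi N d q)) C (C * (N * up_log 2 q)) &
            in_class (S N d q) C (C * (N * up_log 2 q))],
      forall (N d q n : nat) (I : instance N d q n), (d <= c * n)%N ->
        [/\ yes_instance I ->
              accept_prob I (ip_honest (Pi N d q) I) = 1,
            ~ yes_instance I ->
              forall P : prover n (ip_bits (Pi N d q)),
                accept_prob I P <= (N * d)%:R / q%:R + t%:R^-1,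
            single_query (ip_verif (Pi N d q)) I &
            single_query (S N d q) I] &
      simulates c S].
Proof.
exists (fun N d q => projT1 (protocol t c N d q)).
(* The constant covers the $4c+3t+3$ field elements of a message and, for the two reports on an
   edge, $2(N+2t) \le (4t+2)N$. *)
exists (fun N d q => projT2 (protocol t c N d q)), (4 * c + 4 * t + 3)%N.
split.
- move=> N d q q_pr; rewrite /protocol; case: eqP => [_|/eqP] //.
  rewrite muln_eq0 negb_or -!lt0n => /andP[N_gt0 _] /=.
  have L_gt0 : (0 < up_log 2 q)%N by rewrite up_log_gt0 (prime_gt1 q_pr).
  have NL_gt0 : (0 < N * up_log 2 q)%N by rewrite muln_gt0 N_gt0.
  split; first by nia.
  + by rewrite /msg_bits leq_mul2r; apply/orP; right; lia.
  + split; first by rewrite /=; lia.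
    by rewrite /= /report_bits; nia.
  + by split; rewrite /=; nia.
- move=> N d q n I d_le; have q_pr := q_prime I; rewrite /protocol.
  case: eqP => [/eqP Nd0|/eqP].
    split=> [yes|no P|x w|x w].
    + have w0 : ip_sample I (ip_honest (trivial_dIP N d q) I) :=
        ([ffun u => ord0], [ffun u => ord0], ord0).
      by apply: (prob1 w0) => w; rewrite trivial_accept //; apply/eqP.
    + rewrite /accept_prob /prob (_ : [set w | _] = set0).
        by rewrite cards0 mul0r addr_ge0 ?divr_ge0 ?invr_ge0 ?ler0n.
      by apply/setP => w; rewrite !inE trivial_accept //; apply/eqP.
    + exact: trivial_queries.
    + exact: trivial_sim_queries.
  rewrite muln_eq0 negb_or -!lt0n => /andP[N_gt0 d_gt0]; split=> [yes|no P|x w|x w].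
  + exact: main_dIP_complete.
  + exact: main_dIP_sound.
  + exact: main_verif_queries.
  + exact: main_sim_queries.
(* From two nodes on the simulation is perfect, so the threshold does not depend on [p]. *)
- move=> p; exists 2%N => n n_gt1 p_gt0 N d q I d_le yes v.
  have q_pr := q_prime I; rewrite /protocol; case: eqP => [/eqP Nd0|/eqP].
    by rewrite trivial_zero_knowledge invr_ge0 ltW.
  rewrite muln_eq0 negb_or -!lt0n => /andP[N_gt0 d_gt0].
  by rewrite main_dIP_zero_knowledge ?invr_ge0 ?ltW // neq_ltn n_gt1 orbT.
Qed.
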